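(* Let $\Phi$ be a stationary marked point process satisfying the assumptions in the context, and let $\mathcal{I}$ be the invariant $\sigma$-algebra of $(\mathbb{P}^0,\theta)$. If $L_0$ has a strict $\mathbb{P}^0$-tail heavier than $D_0$, then the asymptotic efficiency $e$ of sequential restart exists and is given by the random variable $$e=\frac{\mathbb{E}^0[D_0\mid\mathcal{I}]}{\mathbb{E}^0[T^R_0\mid\mathcal{I}]},\qquad \mathbb{P}^0\text{-a.s.}$$ If $(\mathbb{P},\{\theta_t\}_{t\in\mathbb{R}})$ or, equivalently, $(\mathbb{P}^0,\theta)$ is ergodic, then $\mathbb{E}^0[D_0\mid\mathcal{I}]=\mathbb{E}^0[D_0]$ and $\mathbb{E}^0[T_0^R\mid\mathcal{I}]=\mathbb{E}^0[T_0^R]$, so that the asymptotic efficiency is constant. In this (ergodic) case, if $\mathbb{E}^0[T^R_0]=\infty$, which holds if $D_0$ has a $\mathbb{P}^0$-tail heavier than $L_0$, then $e=0$ $\mathbb{P}^0$-a.s.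
   Context: Let $\mathbb{R}^+=[0,\infty)$. $\Phi=\{(X_n,K_n)\}_{n\in\mathbb{Z}}$ is a simple marked point process on $\mathbb{R}$ (no accumulation points, $X_n<X_{n+1}$, labelled so that $X_0\le 0\le X_1$) with marks $K_n=\{L_{n,i}\}_{i\ge1}\in(\mathbb{R}^+)^{\mathbb{N}}$, on a probability space $(\Omega,\mathcal{F},\mathbb{P},\{\theta_t\}_{t\in\mathbb{R}})$ with a measurable flow (one may take $\Omega$ to be the canonical space of marked counting measures). It is stationary: $\mathbb{P}\circ\theta_t^{-1}=\mathbb{P}$ and $\Phi(\theta_t\omega,C\times B)=\Phi(\omega,(C+t)\times B)$ for all $t\in\mathbb R$ and Borel $C,B$. The intensity $\lambda=\mathbb{E}[\Phi([0,1]\times(\mathbb{R}^+)^{\mathbb{N}})]$ satisfies $0<\lambda<\infty$. $\mathbb{P}^0$ is the Palm probability of $\Phi$: $\mathbb{P}^0[A]=\frac{1}{\lambda|B|}\mathbb{E}\big[\sum_{n}\mathbf{1}\{X_n\in B\}\mathbf{1}\{\Phi\circ\theta_{X_n}\in A\}\big]$ for any Borel $B\subset\mathbb R$ with positive Lebesgue measure $|B|$, where $\Phi\circ\theta_{X_n}=\{(X_m-X_n,K_m)\}_{m}$; $\mathbb{E}^0$ is its expectation; $\mathbb{P}^0$-a.s. $X_0=0$. The discrete left shift is $\theta:\{(X_m,K_m)\}_m\mapsto\{(X_m-X_1,K_m)\}_m$ (relabelled so the old point $X_1$ becomes point number $0$); it preserves $\mathbb{P}^0$. Put $D_n=X_{n+1}-X_n$.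 Assumptions under $\mathbb{P}^0$: (1) for all $n\ge0$, the failure marks $\{L_{n,i}\}_{i\ge1}$ are i.i.d. and independent of $D_n$; (2) $D_0$ and $L_{0,1}$ have right-unbounded support ($\mathbb{P}^0[D_0>x],\mathbb{P}^0[L_{0,1}>x]>0$ for all $x\ge 0$); (3) $\mathbb{E}^0[D_0],\mathbb{E}^0[L_{0,1}]<\infty$. $L_0$ denotes a random variable with $\mathbb{P}^0[L_0>t]=\mathbb{P}^0[L_{n,i}>t]$ for all $i,n,t$. Let $\tau_n=\inf\{k\ge1:L_{n,k}>D_n\}$ and $T^R_n=\sum_{i=1}^{\tau_n-1}L_{n,i}+D_n$ (actual time of task $n$ under restart). The asymptotic efficiency is $e=\lim_{N\to\infty}\frac{\sum_{n=0}^{N-1}D_n}{\sum_{n=0}^{N-1}T^R_n}$, whenever the limit exists $\mathbb{P}^0$-a.s. Tail comparison: $V$ has a $\mathbb{P}^0$-tail heavier than $W$ if there is $z_0$ with $\mathbb{P}^0[V>z]\ge\mathbb{P}^0[W>z]$ for all $z\ge z_0$; $V$ has a strict $\mathbb{P}^0$-tail heavier than $W$ if there are $z_0$ and $\epsilon\in(0,1)$ with $\mathbb{P}^0[V>z]\ge\mathbb{P}^0[W>z]^\epsilon$ for all $z\ge z_0$.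
   Formalization: That ergodicity of the shift under the Palm probability implies ergodicity of the flow is stated only when the events of the probability space are generated by the process, as on the canonical space; on a larger space this implication can fail. *)

(* Defs.v *)
From HB Require Import structures.
From mathcomp Require Export all_boot all_order all_algebra.
From mathcomp Require Export finmap.
From mathcomp Require Export all_classical all_reals all_analysis.
From mathcomp Require Export measurable_realfun.

Set Implicit Arguments.
Unset Strict Implicit.
Unset Printing Implicit Defensive.

Export Order.TTheory GRing.Theory Num.Theory.
Export numFieldNormedType.Exports.

Local Open Scope classical_set_scope.
Local Open Scope ring_scope.
Local Open Scope ereal_scope.

Section configurations.
Variable R : realType.

Definition mark_seq := nat -> {nonneg R}.
HB.instance Definition _ := gen_eqMixin mark_seq.
HB.instance Definition _ := gen_choiceMixin mark_seq.
HB.instance Definition _ :=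
  isPointed.Build mark_seq (fun=> NngNum (lexx (0%R : R))).

Definition mark_cylinders : set (set mark_seq) :=
  \bigcup_i preimage_set_system setT (fun k : mark_seq => (k i)%:num%R)
    (measurable : set (set R)).

(* (R^+)^N with its product sigma-algebra *)
Definition marks := g_sigma_algebraType mark_cylinders.
HB.instance Definition _ := Measurable.on marks.

Definition config_cylinders : set (set (int -> R * marks)) :=
  \bigcup_n preimage_set_system setT (fun m => m n)
    (measurable : set (set (R * marks)%type)).

(* Arbitrary bi-infinite sequences; monotonicity, labelling and local
   finiteness are imposed by [is_point_sequence]. *)
Definition config := g_sigma_algebraType config_cylinders.
HB.instance Definition _ := Measurable.on config.

Definition X (n : int) (m : config) : R := (m n).1.
Definition K (n : int) (m : config) : marks := (m n).2.

(* 0-based in the index of the mark: [L n i] is L_{n,i+1}. *)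
Definition L (n : int) (i : nat) (m : config) : R := (K n m i)%:num%R.

Definition D (n : int) (m : config) : R := (X (n + 1)%R m - X n m)%R.

(* The clause on intervals excludes accumulation points. *)
Definition is_point_sequence (m : config) : Prop :=
  [/\ forall n : int, (X n m < X (n + 1)%R m)%R,
      (X 0%R m <= 0 <= X 1%R m)%R &
      forall a b : R, finite_set [set n : int | (a <= X n m <= b)%R]].

Definition point_count (m : config) (S : set (R * marks)) : \bar R :=
  \esum_(n in [set: int]) (\1_S (m n))%:E.

(* The configuration seen from its n-th point, which becomes point number 0. *)
Definition recenter (n : int) (m : config) : config :=
  fun k : int => ((X (n + k)%R m - X n m)%R, K (n + k)%R m).

Definition shift : config -> config := recenter 1%R.

(* inf of the empty set is +oo *)
Definition tau (n : int) (m : config) : \bar R :=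
  ereal_inf [set (i.+1%:R%:E : \bar R) | i in [set i | (D n m < L n i m)%R]].

(* [L n i] is the (i+1)-st mark, hence the condition i.+1 < tau. *)
Definition TR (n : int) (m : config) : \bar R :=
  (\sum_(0 <= i <oo | ((i.+1%:R : R)%:E < tau n m)%E) (L n i m)%:E)
  + (D n m)%:E.

(* With the convention x / +oo = 0. *)
Definition efficiency_ratio (N : nat) (m : config) : \bar R :=
  (\sum_(n < N) (D n%:Z m)%:E) / (\sum_(n < N) TR n%:Z m).

Definition has_asymptotic_efficiency (P0 : probability config R)
    (e : config -> \bar R) : Prop :=
  {ae P0, forall m, efficiency_ratio N m @[N --> \oo] --> e m}.

End configurations.

Section probability_notions.
Context d (T : measurableType d) (R : realType) (P : probability T R).

Definition mutually_independent (Y : nat -> T -> R) : Prop :=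
  forall (J : {fset nat}) (B : nat -> set R),
    (forall i, measurable (B i)) ->
    P (\bigcap_(i in [set` J]) (Y i @^-1` B i)) =
    \prod_(i <- J) P (Y i @^-1` B i).

Definition identically_distributed (Y : nat -> T -> R) : Prop :=
  forall (i j : nat) (B : set R), measurable B ->
    P (Y i @^-1` B) = P (Y j @^-1` B).

Definition iid (Y : nat -> T -> R) : Prop :=
  mutually_independent Y /\ identically_distributed Y.

Definition independent d1 d2 (T1 : measurableType d1) (T2 : measurableType d2)
    (Y1 : T -> T1) (Y2 : T -> T2) : Prop :=
  forall (A : set T1) (B : set T2), measurable A -> measurable B ->
    P (Y1 @^-1` A `&` Y2 @^-1` B) = P (Y1 @^-1` A) * P (Y2 @^-1` B).

Definition unbounded_support (Y : T -> R) : Prop :=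
  forall x : R, (0 <= x)%R -> 0 < P [set w | (x < Y w)%R].

Definition heavier_tail (V W : T -> R) : Prop :=
  exists z0 : R, forall z : R, (z0 <= z)%R ->
    P [set w | (z < W w)%R] <= P [set w | (z < V w)%R].

Definition strictly_heavier_tail (V W : T -> R) : Prop :=
  exists (z0 eps : R), (0 < eps < 1)%R /\
    forall z : R, (z0 <= z)%R ->
      poweR (P [set w | (z < W w)%R]) eps <= P [set w | (z < V w)%R].

Definition invariant_sets (f : T -> T) : set (set T) :=
  [set A | measurable A /\ f @^-1` A = A].

Definition ergodic_map (f : T -> T) : Prop :=
  forall A, invariant_sets f A -> P A = 0 \/ P A = 1.

Definition ergodic_flow (theta : R -> T -> T) : Prop :=
  forall A, measurable A -> (forall t, theta t @^-1` A = A) ->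
    P A = 0 \/ P A = 1.

(* [Y] is a version of E[f | G] for a sub-sigma-algebra [G]; [f] is P-integrable
   or almost surely nonnegative, possibly with infinite mean. *)
Definition is_cond_exp (G : set (set T)) (f Y : T -> \bar R) : Prop :=
  (forall B : set (\bar R), measurable B -> G (Y @^-1` B)) /\
  (forall A, G A -> \int[P]_(w in A) Y w = \int[P]_(w in A) f w).

(* A version of E[f | G]; the default value is used only if there is none. *)
Definition cond_exp (G : set (set T)) (f : T -> \bar R) : T -> \bar R :=
  xget (cst 0) (is_cond_exp G f).

End probability_notions.

Section stationary_marked_point_process.
Context d (Omega : measurableType d) (R : realType) (P : probability Omega R).

Definition measurable_flow (theta : R -> Omega -> Omega) : Prop :=
  [/\ measurable_fun setT (fun p : R * Omega => theta p.1 p.2),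
      (forall w, theta 0%R w = w) &
      forall s t w, theta (s + t)%R w = theta s (theta t w)].

Definition marked_point_process (Phi : Omega -> config R) : Prop :=
  measurable_fun setT Phi /\ forall w, is_point_sequence (Phi w).

Definition stationary (theta : R -> Omega -> Omega) (Phi : Omega -> config R)
    : Prop :=
  (forall t (A : set Omega), measurable A -> P (theta t @^-1` A) = P A) /\
  (forall t w (C : set R) (B : set (marks R)), measurable C -> measurable B ->
     point_count (Phi (theta t w)) (C `*` B) =
     point_count (Phi w) ([set (x + t)%R | x in C] `*` B)).

Definition intensity (Phi : Omega -> config R) : \bar R :=
  \int[P]_w point_count (Phi w) (`[0%R, 1%R] `*` setT).

(* [B] of finite measure; by stationarity a single such [B] determines [P0]. *)
Definition is_palm (Phi : Omega -> config R) (P0 : probability (config R) R)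
    : Prop :=
  forall (A : set (config R)) (B : set R), measurable A -> measurable B ->
    0 < lebesgue_measure B -> lebesgue_measure B < +oo ->
    P0 A = (intensity Phi * lebesgue_measure B)^-1 *
      \int[P]_w \esum_(n in [set: int])
        (\1_B (X n (Phi w)) * \1_A (recenter n (Phi w)))%:E.

(* Omega carries no events beyond those of [Phi], as on the canonical space. *)
Definition generated_by (Phi : Omega -> config R) : Prop :=
  forall A : set Omega, measurable A ->
    exists2 C : set (config R), measurable C & A = Phi @^-1` C.

End stationary_marked_point_process.

(* Main.v *)
Require Import Defs.
From mathcomp Require Import lra ring zify.

(** The efficiency ratio is a quotient of two Birkhoff averages. Since [D n] and
    [TR n] are [D 0] and [TR 0] read after [n] shifts ([D_iter_shift],
    [TR_iter_shift]), and since the Palm probability is preserved by the shift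
    ([palm_shift]), the pointwise ergodic theorem [birkhoff] makes the averages
    of the [D n] and of the [TR n] converge almost surely to the conditional
    expectations of [D 0] and [TR 0] given the invariant sets. The first limit is
    positive and finite, the second one is positive, possibly [+oo]; in both
    cases the quotient of the averages tends to the quotient of the limits
    ([cvg_ereal_ratio]).

    As [TR 0] may have infinite mean, the ergodic theorem is proved for
    nonnegative functions, by the covering argument of Katznelson and Weiss. If
    every orbit starting in an invariant set [A] has an average of [f] above the
    invariant function [b], then an orbit can be cut into blocks on each of which
    the average is at least [b], whence the integral of [b] over [A] is at most
    the one of [f] ([le_integral_cover]). Applied to the upper limit of the
    averages, and to the lower limit after exchanging [f] with [j - min(f, j)],
    it yields
      int_A limsup <= int_A f <= int_A liminf,
    so that the two limits are versions of one conditional expectation, and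
    versions agree almost surely ([is_cond_exp_unique]). Under ergodicity the
    constant [int f] is a version as well, which identifies the limits with
    plain expectations.

    The Palm formula turns statements about [P0] into statements about all the
    recentred configurations of [Phi w]. An event of [P0] is null when the
    recentred configurations almost surely avoid it ([palm_null]), and conversely
    ([palm_null_inv]). Moving the origin along the flow only relabels the points
    ([flow_relabel]), so a shift-invariant event pulls back to a flow-invariant
    one with the same null or full character; in the other direction, a
    flow-invariant event is recognized on the configuration seen from the
    midpoint of two consecutive points ([generated_invariant_shift]).

    Finally, on the event [D 0 > x], task 0 loses at least as much time as it
    would with the task length [x]. The number of attempts of length at most [x]
    is geometric and independent of [D 0], so that the time lost on this event
    has mean at least
      P0 [D 0 > x] P0 [1 < L <= x] / P0 [L > x],
    which stays away from 0 as [x] grows if the tail of [D 0] dominates the one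
    of [L]; an integrable function cannot do that
    ([lost_time_infinite_mean]). *)

Set Implicit Arguments.
Unset Strict Implicit.
Unset Printing Implicit Defensive.
Local Open Scope classical_set_scope.
Local Open Scope ring_scope.
Local Open Scope ereal_scope.

(** * Upper and lower limits of real sequences *)

Section limsup.
Variable R : realType.
Implicit Types (u v : nat -> R).

Lemma ereal_dense (x y : \bar R) : x < y -> exists r : R, x < r%:E < y.
Proof.
case: x y => [x| |] [y| |] //=.
- rewrite lte_fin => xy; exists ((x + y) / 2)%R; rewrite !lte_fin; lra.
- by move=> _; exists (x + 1)%R; rewrite lte_fin ltry andbT; lra.
- by move=> _; exists (y - 1)%R; rewrite lte_fin ltNyr /=; lra.
- by move=> _; exists 0%R; rewrite ltry ltNyr.
Qed.

Lemma limn_esup_infE (w : nat -> \bar R) :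
  limn_esup w = ereal_inf (range (esups w)).
Proof. by rewrite limn_esup_lim; apply/cvg_lim => //; exact: cvg_esups_inf. Qed.

Lemma limn_esup_gt (w : nat -> \bar R) q : q < limn_esup w ->
  forall N, exists2 n, (N <= n)%N & q < w n.
Proof.
rewrite limn_esup_infE => qw N.
have : q < esups w N.
  by apply: (lt_le_trans qw); apply: ereal_inf_lbound; exists N.
by move=> /ereal_sup_gt[_ [n /= Nn <-]] ?; exists n.
Qed.

Lemma limn_esup_ge (w : nat -> \bar R) q :
  (forall N, exists2 n, (N <= n)%N & q <= w n) -> q <= limn_esup w.
Proof.
rewrite limn_esup_infE => qw; apply: le_ereal_inf_tmp => _ [N _ <-] /=.
have [n Nn /le_trans] := qw N; apply.
by apply: ereal_sup_ubound; exists n.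
Qed.

(** Comparison along frequent events: it is enough that whenever [u] exceeds a
    level late, [v] exceeds any lower level about as late, because the upper
    limit is the supremum of the levels that are exceeded infinitely often. *)
Lemma limn_esup_le u v :
  (forall q' q : R, (q' < q)%R -> exists N, forall n, (N <= n)%N -> (q < u n)%R ->
     exists2 m, (n <= m.+1)%N & (q' < v m)%R) ->
  limn_esup (EFin \o u) <= limn_esup (EFin \o v).
Proof.
move=> uv; rewrite leNgt; apply/negP => /ereal_dense[q' /andP[vq' q'u]].
have [q /andP[q'q qu]] := ereal_dense q'u.
have [N HN] := uv q' q q'q.
move: vq'; rewrite ltNge => /negP; apply; apply: limn_esup_ge => M.
have [n] := limn_esup_gt qu (maxn N M.+1).
rewrite geq_max => /andP[Nn Mn] qun.
have [m nm q'm] := HN n Nn qun.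
exists m; first by rewrite -ltnS (leq_trans Mn).
by rewrite lee_fin ltW.
Qed.

Lemma near_lt_affine (q' q c : R) : (q' < q)%R ->
  exists N : nat, forall n, (N <= n)%N -> (q' * n.+1%:R < q * n%:R + c)%R.
Proof.
move=> q'q; exists (Num.bound (`|q' - c| / (q - q'))%R) => n Nn.
have : (`|q' - c| / (q - q') < n%:R)%R.
  apply: (@lt_le_trans _ _ (Num.bound (`|q' - c| / (q - q')))%:R%R).
    by apply: archi_boundP; rewrite divr_ge0 ?normr_ge0 ?subr_ge0 ?(ltW q'q).
  by rewrite ler_nat.
rewrite ltr_pdivrMr ?subr_gt0// => H.
have := ler_norm (q' - c)%R; rewrite -natr1; nra.
Qed.

(** The relation holds between the Birkhoff averages at [x] and at its image,
    with [c] the value at [x]: this is why the upper limit of the averages is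
    exactly invariant, also where it is infinite. *)
Lemma limn_esup_succ u v c :
  (forall n, n.+1%:R * u n.+1 = n%:R * v n + c)%R ->
  limn_esup (EFin \o u) = limn_esup (EFin \o v).
Proof.
move=> uv; apply/eqP; rewrite eq_le; apply/andP; split; apply: limn_esup_le.
- move=> q' q q'q; have [N HN] := near_lt_affine (q + q' - c)%R q'q.
  exists N.+2 => -[//|n] Nn qu; exists n => //.
  have n0 : (0 < n%:R :> R)%R by rewrite ltr0n; lia.
  suff : (q' * n%:R < v n * n%:R)%R by rewrite ltr_pM2r.
  have := HN n (ltnW Nn); have := uv n.
  rewrite -(@ltr_pM2r _ n.+1%:R%R) ?ltr0n// in qu; move: qu.
  by rewrite -natr1; lra.
- move=> q' q q'q; have [N HN] := near_lt_affine c q'q.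
  exists N.+1 => n Nn qv; exists n.+1 => //; first by lia.
  have n0 : (0 < n%:R :> R)%R by rewrite ltr0n; lia.
  suff : (q' * n.+1%:R < u n.+1 * n.+1%:R)%R by rewrite ltr_pM2r// ltr0n.
  have := HN n (ltnW Nn); have := uv n.
  by rewrite -(@ltr_pM2r _ n%:R%R) // in qv; lra.
Qed.

Lemma limn_einf_EFin u :
  limn_einf (EFin \o u) = - limn_esup (EFin \o (fun n => - u n)%R).
Proof. by rewrite /limn_einf; congr (- limn_esup _); apply/funext. Qed.

Lemma limn_einf_succ u v c :
  (forall n, n.+1%:R * u n.+1 = n%:R * v n + c)%R ->
  limn_einf (EFin \o u) = limn_einf (EFin \o v).
Proof.
move=> uv; rewrite !limn_einf_EFin; congr (- _).
by apply: (@limn_esup_succ _ _ (- c)%R) => n; have := uv n; lra.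
Qed.

Lemma limn_einf_lt (w : nat -> \bar R) q : limn_einf w < q ->
  forall N, exists2 n, (N <= n)%N & w n < q.
Proof.
rewrite /limn_einf lteNl => /limn_esup_gt H N.
by have [n Nn] := H N; rewrite lteN2 => ?; exists n.
Qed.

Lemma cvg_limn_esup_einf (w : nat -> \bar R) :
  limn_esup w = limn_einf w -> w @ \oo --> limn_esup w.
Proof.
move=> H; apply: (@squeeze_cvge _ _ _ _ (einfs w) _ (esups w)).
- apply: nearW => n; apply/andP; split.
    by apply: ereal_inf_lbound; exists n => /=.
  by apply: ereal_sup_ubound; exists n => /=.
- by rewrite H limn_einf_lim; exact: is_cvg_einfs.
- by rewrite limn_esup_lim; exact: is_cvg_esups.
Qed.

End limsup.

(** * Birkhoff sums and the covering argument *)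

Section birkhoff_sums.
Context d (T : measurableType d) (R : realType) (th : T -> T).

Definition birkhoff_sum (f : T -> R) n x : R := (\sum_(k < n) f (iter k th x))%R.

Lemma birkhoff_sumS f n x :
  birkhoff_sum f n.+1 x = (f x + birkhoff_sum f n (th x))%R.
Proof.
rewrite /birkhoff_sum big_ord_recl; congr (_ + _)%R.
by apply: eq_bigr => i _; rewrite -iterSr.
Qed.

Lemma birkhoff_sumSr f n x :
  birkhoff_sum f n.+1 x = (birkhoff_sum f n x + f (iter n th x))%R.
Proof. by rewrite /birkhoff_sum big_ord_recr. Qed.

Lemma birkhoff_sum_cat f m n x :
  birkhoff_sum f (m + n) x =
  (birkhoff_sum f m x + birkhoff_sum f n (iter m th x))%R.
Proof.
elim: n => [|n IH]; first by rewrite addn0 {3}/birkhoff_sum big_ord0 addr0.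
by rewrite addnS !birkhoff_sumSr IH -addrA -iterD addnC.
Qed.

Lemma birkhoff_sum_ge0 f n x : (forall y, 0 <= f y)%R -> (0 <= birkhoff_sum f n x)%R.
Proof. by move=> f0; apply: sumr_ge0. Qed.

Lemma le_birkhoff_sum f g n x : (forall y, f y <= g y)%R ->
  (birkhoff_sum f n x <= birkhoff_sum g n x)%R.
Proof. by move=> fg; apply: ler_sum. Qed.

Lemma iter_invariant (A : set T) n x : th @^-1` A = A -> A (iter n th x) = A x.
Proof. by move=> AA; elim: n => //= n <-; rewrite -[in RHS]AA. Qed.

(** Greedy covering of an orbit: as long as more than [N] steps remain, jump over
    a block of length at most [N] on which the sum is large. Only the last
    incomplete block, of length at most [N], is lost. *)
Lemma birkhoff_sum_cover (g b : T -> R) (A : set T) (N : nat) :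
  (forall x, 0 <= g x)%R -> (forall x, 0 <= b x)%R ->
  (forall x, b (th x) = b x) -> th @^-1` A = A ->
  (forall x, A x -> exists n,
     [/\ (0 < n)%N, (n <= N)%N & (n%:R * b x <= birkhoff_sum g n x)%R]) ->
  forall K x, A x -> ((K%:R - N%:R) * b x <= birkhoff_sum g K x)%R.
Proof.
move=> g0 b0 bth Ath cov; elim/ltn_ind => K IH x Ax.
have [KN|NK] := leqP K N.
  apply: le_trans (birkhoff_sum_ge0 _ _ g0).
  by rewrite mulr_le0_ge0// subr_le0 ler_nat.
have [n [n0 nN nb]] := cov x Ax.
have -> : K = (n + (K - n))%N by lia.
have bn : b (iter n th x) = b x by elim: (n) => //= m <-.
rewrite birkhoff_sum_cat.
have := IH (K - n)%N _ (iter n th x); rewrite iter_invariant// bn.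
move=> /(_ _ Ax) IHn; have {}IHn := IHn ltac:(lia).
by rewrite natrD; lra.
Qed.

End birkhoff_sums.

Section maximal_inequality.
Context d (T : measurableType d) (R : realType) (mu : probability T R).
Variable th : T -> T.
Hypothesis mth : measurable_fun setT th.
Hypothesis mu_th : forall A, measurable A -> mu (th @^-1` A) = mu A.

Let I := invariant_sets th.

Lemma measurable_iter k : measurable_fun setT (iter k th).
Proof.
elim: k => [|k IH]; first exact: measurable_id.
exact: (measurableT_comp mth IH).
Qed.

Lemma ge0_integral_comp_invariant (f : T -> \bar R) A : I A ->
  measurable_fun setT f -> (forall x, 0 <= f x) ->
  \int[mu]_(x in A) f (th x) = \int[mu]_(x in A) f x.
Proof.
move=> [mA Ath] mf f0.
have := @ge0_integral_pushforward _ _ _ _ _ _ mth mu A f mA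
  (measurable_funTS mf) (fun y _ => f0 y).
rewrite Ath => <-.
by apply: eq_measure_integral => B mB _; rewrite /pushforward; exact: mu_th.
Qed.

Lemma measurable_birkhoff_sum (f : T -> R) n : measurable_fun setT f ->
  measurable_fun setT (birkhoff_sum th f n).
Proof.
move=> mf; apply: (@measurable_sum _ _ _ setT _ _
  (fun (k : 'I_n) x => f (iter k th x))) => k.
exact: (measurableT_comp mf (measurable_iter k)).
Qed.

Lemma integral_birkhoff_sum (f : T -> R) A n : I A ->
  measurable_fun setT f -> (forall x, 0 <= f x)%R ->
  \int[mu]_(x in A) (birkhoff_sum th f n x)%:E =
  n%:R%:E * \int[mu]_(x in A) (f x)%:E.
Proof.
move=> IA mf f0; have [mA _] := IA; elim: n => [|n IH].
  rewrite mul0e; under eq_integral do rewrite /birkhoff_sum big_ord0.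
  exact: integral0.
have mfE : measurable_fun setT (EFin \o f) by exact/measurable_EFinP.
under eq_integral do rewrite birkhoff_sumS EFinD.
have mS := measurable_birkhoff_sum n mf.
rewrite ge0_integralD//; last 4 first.
- by move=> x _; rewrite lee_fin.
- exact: measurable_funS mfE.
- by move=> x _; rewrite lee_fin birkhoff_sum_ge0.
- apply: (@measurable_funS _ _ _ _ setT) => //; apply/measurable_EFinP.
  exact: (measurableT_comp mS).
rewrite (@ge0_integral_comp_invariant (EFin \o birkhoff_sum th f n))//.
- by rewrite /= IH -natr1 addeC EFinD ge0_muleDl ?mul1e ?lee_fin.
- exact/measurable_EFinP.
- by move=> x; rewrite lee_fin birkhoff_sum_ge0.
Qed.

End maximal_inequality.

Section birkhoff.
Context d (T : measurableType d) (R : realType) (mu : probability T R).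
Variable th : T -> T.
Hypothesis mth : measurable_fun setT th.
Hypothesis mu_th : forall A, measurable A -> mu (th @^-1` A) = mu A.

Let I := invariant_sets th.
Let S (f : T -> R) := birkhoff_sum th f.

Lemma measurable_ltr_set (f g : T -> R) : measurable_fun setT f ->
  measurable_fun setT g -> measurable [set x | (f x < g x)%R].
Proof.
move=> mf mg; have := measurable_fun_ltr mf mg measurableT (Y := [set true]) Logic.I.
by rewrite setTI; apply.
Qed.

(** The block lengths are not bounded, so [f] is increased by [b] on the set [E N]
    of the points that need a block longer than [N]; there a block of length 1
    suffices. Integrating the greedy lower bound over [K] steps and letting
    [K] grow gives the claim up to the integral of [b] over [E N], which vanishes
    as [N] grows. *)
Lemma le_integral_cover (f b : T -> R) (M : R) (A : set T) :
  measurable_fun setT f -> measurable_fun setT b ->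
  (forall x, 0 <= f x)%R -> (forall x, 0 <= b x <= M)%R ->
  (forall x, b (th x) = b x) -> I A ->
  (forall x, A x -> exists2 n, (0 < n)%N & (n%:R * b x <= S f n x)%R) ->
  \int[mu]_(x in A) (b x)%:E <= \int[mu]_(x in A) (f x)%:E.
Proof.
move=> mf mb f0 bM bth IA cov; have [mA Ath] := IA.
have b0 x : (0 <= b x)%R by have /andP[] := bM x.
have mbE : measurable_fun A (EFin \o b).
  by apply: measurable_funTS; exact/measurable_EFinP.
have mfE : measurable_fun A (EFin \o f).
  by apply: measurable_funTS; exact/measurable_EFinP.
pose E N := A `&` \bigcap_(n in [set n | (0 < n <= N)%N])
  [set x | (S f n x < n%:R * b x)%R].
have mE N : measurable (E N).
  apply: measurableI => //; apply: bigcap_measurableType => n _.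
  apply: measurable_ltr_set; first exact: measurable_birkhoff_sum.
  exact: measurable_funM.
pose g N x := (f x + b x * \1_(E N) x)%R.
have mbE1 N : measurable_fun setT (fun x => b x * \1_(E N) x)%R.
  by apply: measurable_funM => //; exact: measurable_indic.
have mg N : measurable_fun setT (g N) by exact: measurable_funD.
have fg N x : (f x <= g N x)%R by rewrite lerDl mulr_ge0.
have g0 N x : (0 <= g N x)%R by apply: le_trans (fg N x).
have covg N K x : A x -> ((K%:R - N.+1%:R) * b x <= S (g N.+1) K x)%R.
  apply: birkhoff_sum_cover => // {K}x Ax.
  have [xE|xE] := pselect (E N.+1 x).
    exists 1%N; split => //; rewrite birkhoff_sumS /birkhoff_sum big_ord0 addr0.
    by rewrite /g indicE mem_set// mul1r mulr1 lerDr.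
  have [n [n0 nN b1]] : exists n, [/\ (0 < n)%N, (n <= N.+1)%N &
      (n%:R * b x <= S f n x)%R].
    apply: contrapT => H; apply: xE; split => // n /= /andP[n0 nN].
    by rewrite ltNge; apply/negP => ?; apply: H; exists n.
  by exists n; split => //; apply: (le_trans b1); exact: le_birkhoff_sum.
pose beta := \int[mu]_(x in A) (b x)%:E; pose phi := \int[mu]_(x in A) (f x)%:E.
have beta0 : 0 <= beta by apply: integral_ge0 => x _; rewrite lee_fin.
have phi0 : 0 <= phi by apply: integral_ge0 => x _; rewrite lee_fin.
have M0 : (0 <= M)%R by have /andP[/le_trans h /h] := bM point.
have intE N : \int[mu]_(x in A) (b x * \1_(E N) x)%:E <= M%:E * mu (E N).
  apply: (@le_trans _ _ (\int[mu]_(x in A) (M%:E * (\1_(E N) x)%:E))).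
    apply: ge0_le_integral => //.
    - by move=> x _; rewrite lee_fin mulr_ge0.
    - by apply: measurable_funTS; exact/measurable_EFinP.
    - apply: measurable_funTS; apply/measurable_EFinP.
      by apply: measurable_funM => //; exact: measurable_indic.
    - by move=> x _; rewrite -EFinM lee_fin ler_wpM2r//; have /andP[] := bM x.
  rewrite ge0_integralZl//; last first.
    by apply: measurable_funTS; apply/measurable_EFinP; exact: measurable_indic.
  rewrite integral_indic// lee_wpmul2l ?lee_fin// le_measure ?inE//.
  exact: measurableI.
have [phioo|phifin] := eqVneq phi +oo; first by rewrite -/phi phioo leey.
have {}phifin : phi \is a fin_num by rewrite ge0_fin_numE// ltey.
have betafin : beta \is a fin_num.
  rewrite ge0_fin_numE//; apply: (@le_lt_trans _ _ (\int[mu]_(x in A) M%:E)).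
    apply: ge0_le_integral => //.
    - by move=> x _; rewrite lee_fin.
    - by move=> x _; rewrite lee_fin; have /andP[] := bM x.
  rewrite integral_cst// lte_mul_pinfty// ?lee_fin//.
  by rewrite (le_lt_trans (probability_le1 _ _))// ltry.
(* divide the integrated greedy bound by [K] and let [K] tend to infinity *)
have key N : beta <= phi + M%:E * mu (E N.+1).
  have muEfin : mu (E N.+1) \is a fin_num by exact: fin_num_measure.
  rewrite leNgt; apply/negP.
  rewrite -(fineK betafin) -(fineK phifin) -(fineK muEfin) -EFinM -EFinD lte_fin.
  set B := fine beta; set G := (_ + _)%R => GB.
  have main K : (N.+1 <= K)%N -> ((K%:R - N.+1%:R) * B <= K%:R * G)%R.
    move=> NK; rewrite -lee_fin EFinM fineK// EFinM.
    have -> : (K%:R - N.+1%:R)%:E * beta =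
        \int[mu]_(x in A) ((K%:R - N.+1%:R) * b x)%:E.
      under eq_integral do rewrite EFinM.
      rewrite ge0_integralZl//.
        by move=> x _; rewrite lee_fin.
      by rewrite lee_fin subr_ge0 ler_nat.
    apply: (@le_trans _ _ (\int[mu]_(x in A) (S (g N.+1) K x)%:E)).
      apply: ge0_le_integral => //.
      - by move=> x _; rewrite lee_fin mulr_ge0// subr_ge0 ler_nat.
      - apply: measurable_funTS; apply/measurable_EFinP.
        by apply: measurable_funM.
      - apply: measurable_funTS; apply/measurable_EFinP.
        exact: measurable_birkhoff_sum.
      - by move=> x Ax; rewrite lee_fin; exact: covg.
    rewrite (integral_birkhoff_sum mth mu_th K IA (mg _) (g0 _)).
    apply: lee_wpmul2l; first by rewrite lee_fin.
    rewrite /g; under eq_integral do rewrite EFinD.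
    rewrite ge0_integralD//; last 3 first.
    - by move=> x _; rewrite lee_fin.
    - by move=> x _; rewrite lee_fin mulr_ge0.
    - by apply: measurable_funTS; exact/measurable_EFinP.
    rewrite EFinD fineK//; apply: leeD => //.
    by rewrite EFinM fineK//; exact: intE.
  have [K NK HK] : exists2 K, (N.+1 <= K)%N & (N.+1%:R * B < K%:R * (B - G))%R.
    have BG : (0 < B - G)%R by rewrite subr_gt0.
    exists (N.+1 + Num.bound (N.+1%:R * B / (B - G)))%N; first exact: leq_addr.
    rewrite -ltr_pdivrMr// natrD; apply: ltr_wpDl => //.
    by apply: archi_boundP; rewrite divr_ge0 ?mulr_ge0 ?(ltW BG)// fine_ge0.
  by have := main K NK; move: HK; rewrite !mulrBr mulrBl; lra.
have cvgE : mu (E n.+1) @[n --> \oo] --> 0.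
  have -> : 0 = mu (\bigcap_n E n.+1).
    rewrite -[LHS](measure0 mu); congr (mu _); apply/esym/seteqP; split => // x Ex.
    have [Ax _] := Ex 0%N Logic.I; have [n n0 nb] := cov x Ax.
    have [_ /(_ n) /=] := Ex n Logic.I.
    by rewrite n0 leqW//= ltNge nb => /(_ isT).
  apply: nonincreasing_cvg_mu => //.
  - by rewrite (le_lt_trans (probability_le1 _ _))// ltry.
  - exact: bigcapT_measurable.
  - move=> m n mn; apply/subsetPset => x [Ax H]; split => // k /= /andP[k0 km].
    by apply: H; rewrite /= k0 (leq_trans km).
have : (phi + M%:E * mu (E n.+1)) @[n --> \oo] --> phi + M%:E * 0.
  apply: cvgeD; first by rewrite mule0 fin_num_adde_defl.
  - exact: cvg_cst.
  - by apply: cvgeZl.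
rewrite mule0 adde0 -/phi -/beta => /cvg_lim <- //.
apply: lime_ge; last by apply: nearW => n; exact: key.
apply/cvg_ex; exists (phi + M%:E * 0).
apply: cvgeD; first by rewrite mule0 fin_num_adde_defl.
- exact: cvg_cst.
- by apply: cvgeZl.
Qed.

End birkhoff.

(** * Upper and lower limits of Birkhoff averages *)

Section birkhoff_limits.
Context d (T : measurableType d) (R : realType) (mu : probability T R).
Variable th : T -> T.
Hypothesis mth : measurable_fun setT th.
Hypothesis mu_th : forall A, measurable A -> mu (th @^-1` A) = mu A.

Let I := invariant_sets th.
Let S (f : T -> R) := birkhoff_sum th f.

(** An upper limit is approached, not reached, by the averages, hence this
    form with a tolerance; it is the previous one for [f + e]. *)
Lemma le_integral_cover_eps (f b : T -> R) (M : R) (A : set T) :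
  measurable_fun setT f -> measurable_fun setT b ->
  (forall x, 0 <= f x)%R -> (forall x, 0 <= b x <= M)%R ->
  (forall x, b (th x) = b x) -> I A ->
  (forall x e, A x -> (0 < e)%R ->
     exists2 n, (0 < n)%N & (n%:R * (b x - e) <= S f n x)%R) ->
  \int[mu]_(x in A) (b x)%:E <= \int[mu]_(x in A) (f x)%:E.
Proof.
move=> mf mb f0 bM bth IA cov; have [mA Ath] := IA.
apply/lee_addgt0Pr => e e0.
apply: (@le_trans _ _ (\int[mu]_(x in A) (f x + e)%:E)).
  apply: (le_integral_cover mth mu_th _ mb _ bM bth IA).
  - exact: measurable_funD.
  - by move=> x; rewrite addr_ge0// ltW.
  - move=> x Ax; have [n n0 nS] := cov x e Ax e0; exists n => //.
    have -> : birkhoff_sum th (fun y => f y + e)%R n x = (S f n x + n%:R * e)%R.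
      rewrite /S /birkhoff_sum big_split/=; congr (_ + _)%R.
      by rewrite sumr_const card_ord mulr_natl.
    by move: nS; rewrite mulrBr lerBlDr.
under eq_integral do rewrite EFinD.
rewrite ge0_integralD//; last 3 first.
- by move=> x _; rewrite lee_fin.
- by apply: measurable_funTS; exact/measurable_EFinP.
- by move=> x _; rewrite lee_fin ltW.
rewrite leeD2l// integral_cst// -[leRHS]mule1 lee_wpmul2l ?lee_fin ?(ltW e0)//.
exact: probability_le1.
Qed.

Lemma cvg_mine_nat (y : \bar R) : mine y n%:R%:E @[n --> \oo] --> y.
Proof.
case: y => [r| |].
- apply: cvg_near_cst; exists (Num.bound `|r|%R) => //= n /= bn.
  apply: min_l; rewrite lee_fin (le_trans (ler_norm _))//.
  apply: (@le_trans _ _ (Num.bound `|r|%R)%:R%R); last by rewrite ler_nat.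
  by apply/ltW/archi_boundP.
- apply: (@cvg_trans _ ((n%:R : R)%:E @[n --> \oo])); last exact/cvgeryP/cvgr_idn.
  by apply: near_eq_cvg; apply: nearW => n; rewrite min_r// leey.
- apply: cvg_near_cst; apply: nearW => n.
  by apply: min_l; rewrite leNye.
Qed.

(** Monotone convergence, to reduce bounds on possibly infinite functions to the
    bounded functions that the covering argument needs. *)
Lemma ge0_integral_le_trunc (f : T -> \bar R) (A : set T) C :
  measurable A -> measurable_fun setT f -> (forall x, 0 <= f x) ->
  (forall j : nat, \int[mu]_(x in A) mine (f x) j%:R%:E <= C) ->
  \int[mu]_(x in A) f x <= C.
Proof.
move=> mA mf f0 fC.
have mfj j : measurable_fun A (fun x => mine (f x) j%:R%:E).
  by apply: measurable_funTS; exact: measurable_mine.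
have fj0 j x : 0 <= mine (f x) j%:R%:E by rewrite le_min f0 lee_fin ler0n.
have ndj x : nondecreasing_seq (fun j => mine (f x) j%:R%:E).
  move=> i j ij; rewrite le_min ge_min lexx/= ge_min lee_fin ler_nat ij.
  exact: orbT.
have -> : \int[mu]_(x in A) f x =
    limn (fun j => \int[mu]_(x in A) mine (f x) j%:R%:E).
  rewrite -monotone_convergence//; apply: eq_integral => x _.
  by apply/esym/cvg_lim => //; exact: cvg_mine_nat.
apply: lime_le; last by apply: nearW => j; exact: fC.
apply: ereal_nondecreasing_is_cvgn => i j ij.
by apply: ge0_le_integral => // x _; exact: ndj.
Qed.

Definition birkhoff_mean (f : T -> R) n x : \bar R := (S f n x / n%:R)%:E.
Definition birkhoff_limsup (f : T -> R) x := limn_esup (birkhoff_mean f ^~ x).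
Definition birkhoff_liminf (f : T -> R) x := limn_einf (birkhoff_mean f ^~ x).

Lemma birkhoff_mean_shift (f : T -> R) n x :
  (n.+1%:R * (S f n.+1 x / n.+1%:R) = n%:R * (S f n (th x) / n%:R) + f x)%R.
Proof.
rewrite [LHS]mulrC divfK ?pnatr_eq0// /S birkhoff_sumS addrC; congr (_ + _)%R.
case: n => [|n]; first by rewrite mul0r /birkhoff_sum big_ord0.
by rewrite mulrC divfK ?pnatr_eq0.
Qed.

Lemma birkhoff_limsup_invariant f x : birkhoff_limsup f (th x) = birkhoff_limsup f x.
Proof.
apply/esym; apply: (@limn_esup_succ _ (fun n => S f n x / n%:R)%R
  (fun n => S f n (th x) / n%:R)%R (f x)) => n.
exact: birkhoff_mean_shift.
Qed.

Lemma birkhoff_liminf_invariant f x : birkhoff_liminf f (th x) = birkhoff_liminf f x.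
Proof.
apply/esym; apply: (@limn_einf_succ _ (fun n => S f n x / n%:R)%R
  (fun n => S f n (th x) / n%:R)%R (f x)) => n.
exact: birkhoff_mean_shift.
Qed.

Section nonnegative.
Variable f : T -> R.
Hypothesis mf : measurable_fun setT f.
Hypothesis f0 : forall x, (0 <= f x)%R.

Lemma measurable_birkhoff_mean n : measurable_fun setT (birkhoff_mean f n).
Proof.
apply/measurable_EFinP; apply: measurable_funM => //.
exact: measurable_birkhoff_sum.
Qed.

Lemma measurable_birkhoff_limsup : measurable_fun setT (birkhoff_limsup f).
Proof. by apply: measurable_fun_limn_esup => n; exact: measurable_birkhoff_mean. Qed.

Lemma measurable_birkhoff_liminf : measurable_fun setT (birkhoff_liminf f).
Proof.
apply: measurableT_comp => //; apply: measurable_fun_limn_esup => n.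
by apply: measurableT_comp => //; exact: measurable_birkhoff_mean.
Qed.

Lemma birkhoff_mean_ge0 n x : 0 <= birkhoff_mean f n x.
Proof. by rewrite lee_fin divr_ge0//; exact: birkhoff_sum_ge0. Qed.

Lemma birkhoff_liminf_ge0 x : 0 <= birkhoff_liminf f x.
Proof.
rewrite /birkhoff_liminf limn_einf_lim; apply: lime_ge; first exact: is_cvg_einfs.
apply: nearW => N; apply: le_ereal_inf_tmp => _ [n _ <-].
exact: birkhoff_mean_ge0.
Qed.

Lemma birkhoff_limsup_ge0 x : 0 <= birkhoff_limsup f x.
Proof. by rewrite (le_trans (birkhoff_liminf_ge0 x))// limn_einf_sup. Qed.

Let trunc (g : T -> \bar R) (j : nat) x : R := fine (mine (g x) j%:R%:E).

Let truncE (g : T -> \bar R) j x : 0 <= g x ->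
  (trunc g j x)%:E = mine (g x) j%:R%:E.
Proof.
move=> g0; rewrite fineK// ge0_fin_numE; last by rewrite le_min g0 lee_fin ler0n.
by rewrite (@le_lt_trans _ _ j%:R%:E) ?ltry// ge_min lexx orbT.
Qed.

Let trunc_itv (g : T -> \bar R) j x : 0 <= g x -> (0 <= trunc g j x <= j%:R)%R.
Proof.
move=> g0; rewrite -!lee_fin truncE// le_min g0 lee_fin ler0n/=.
by rewrite ge_min lexx orbT.
Qed.

Let measurable_trunc g j : measurable_fun setT g -> measurable_fun setT (trunc g j).
Proof. by move=> mg; apply: measurableT_comp => //; exact: measurable_mine. Qed.

(** Truncations of the upper limit are invariant and are approached by averages
    of [f]: the covering argument applies to them. *)
Lemma integral_birkhoff_limsup_le A : I A ->
  \int[mu]_(x in A) birkhoff_limsup f x <= \int[mu]_(x in A) (f x)%:E.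
Proof.
move=> IA; have [mA _] := IA.
have Y0 := birkhoff_limsup_ge0.
apply: ge0_integral_le_trunc => //; first exact: measurable_birkhoff_limsup.
move=> j; under eq_integral do rewrite -truncE//.
apply: (@le_integral_cover_eps _ _ j%:R%R) => //.
- by apply: measurable_trunc; exact: measurable_birkhoff_limsup.
- by move=> x; exact: trunc_itv.
- by move=> x; rewrite /trunc birkhoff_limsup_invariant.
move=> x e Ax e0.
have : (trunc (birkhoff_limsup f) j x - e)%:E < birkhoff_limsup f x.
  apply: (@lt_le_trans _ _ (trunc (birkhoff_limsup f) j x)%:E).
    by rewrite lte_fin ltrBlDr ltrDl.
  by rewrite truncE// ge_min lexx.
move=> /limn_esup_gt /(_ 1%N)[n n0]; rewrite lte_fin ltr_pdivlMr ?ltr0n// => H.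
by exists n => //; rewrite mulrC ltW.
Qed.

(** The covering argument for [j - min(f, j)], whose averages come arbitrarily
    close to [j] minus the truncated lower limit. *)
Lemma integral_le_birkhoff_liminf A : I A ->
  \int[mu]_(x in A) (f x)%:E <= \int[mu]_(x in A) birkhoff_liminf f x.
Proof.
move=> IA; have [mA _] := IA.
have Y0 := birkhoff_liminf_ge0.
have mY := measurable_birkhoff_liminf.
have mfE : measurable_fun setT (EFin \o f) by exact/measurable_EFinP.
have fE0 x : 0 <= (EFin \o f) x by rewrite lee_fin.
apply: ge0_integral_le_trunc => // j.
under eq_integral do rewrite -[mine _ _](truncE j (fE0 _)).
set m := trunc (birkhoff_liminf f) j; set fj := trunc (EFin \o f) j.
have mm : measurable_fun setT m by exact: measurable_trunc.
have mfj : measurable_fun setT fj by exact: measurable_trunc.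
have mitv x : (0 <= m x <= j%:R)%R by exact: trunc_itv.
have fjitv x : (0 <= fj x <= j%:R)%R by exact: trunc_itv.
have fjf x : (fj x <= f x)%R by rewrite -lee_fin truncE// ge_min lexx.
have H : \int[mu]_(x in A) (j%:R - m x)%:E <= \int[mu]_(x in A) (j%:R - fj x)%:E.
  apply: (@le_integral_cover_eps _ _ j%:R%R) => //.
  - exact: measurable_funB.
  - exact: measurable_funB.
  - by move=> x; rewrite subr_ge0; have /andP[] := fjitv x.
  - by move=> x; rewrite subr_ge0 gerBl andbC; exact: mitv.
  - by move=> x; rewrite /m /trunc birkhoff_liminf_invariant.
  move=> x e Ax e0.
  have SE n : S (fun y => j%:R - fj y)%R n x = (n%:R * j%:R - S fj n x)%R.
    rewrite /S /birkhoff_sum sumrB sumr_const card_ord.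
    by rewrite [in RHS]mulr_natl.
  have [jY|Yj] := leP (j%:R%:E) (birkhoff_liminf f x).
    exists 1%N => //; rewrite SE /S birkhoff_sumS /birkhoff_sum big_ord0 addr0.
    have -> : m x = j%:R by apply: EFin_inj; rewrite truncE// min_r.
    by have /andP[_] := fjitv x; lra.
  have : birkhoff_liminf f x < (m x + e)%:E.
    rewrite EFinD truncE// min_l ?(ltW Yj)// lteDl ?lte_fin//.
    by rewrite ge0_fin_numE// (lt_trans Yj)// ltry.
  move=> /limn_einf_lt /(_ 1%N)[n n0]; rewrite lte_fin ltr_pdivrMr ?ltr0n// => Hn.
  exists n => //; rewrite SE.
  have : (S fj n x <= S f n x)%R by exact: le_birkhoff_sum.
  by move: Hn; rewrite -/(S f n x) !mulrBr mulrDl; lra.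
have intj (g : T -> R) : measurable_fun setT g -> (forall x, 0 <= g x <= j%:R)%R ->
    \int[mu]_(x in A) (j%:R - g x)%:E = j%:R%:E * mu A - \int[mu]_(x in A) (g x)%:E
    /\ \int[mu]_(x in A) (g x)%:E \is a fin_num.
  move=> mg gj.
  have g0 x : (0 <= g x)%R by have /andP[] := gj x.
  have jg0 x : (0 <= j%:R - g x)%R by rewrite subr_ge0; have /andP[] := gj x.
  have gfin : \int[mu]_(x in A) (g x)%:E \is a fin_num.
    rewrite ge0_fin_numE; last by apply: integral_ge0 => x _; rewrite lee_fin.
    apply: (@le_lt_trans _ _ (\int[mu]_(x in A) j%:R%:E)).
      apply: ge0_le_integral => //.
      - by move=> x _; rewrite lee_fin.
      - by apply: measurable_funTS; exact/measurable_EFinP.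
      - by move=> x _; rewrite lee_fin; have /andP[] := gj x.
    rewrite integral_cst// lte_mul_pinfty// ?lee_fin//.
    by rewrite (le_lt_trans (probability_le1 _ _))// ltry.
  split=> //; apply/esym/eqP; rewrite sube_eq//; last 2 first.
  - by rewrite fin_numM// fin_num_measure.
  - by rewrite fin_num_adde_defl// fin_numN.
  have <- : \int[mu]_(x in A) ((j%:R - g x)%:E + (g x)%:E) =
      \int[mu]_(x in A) (j%:R - g x)%:E + \int[mu]_(x in A) (g x)%:E.
    apply: ge0_integralD => //.
    - by move=> x _; rewrite lee_fin.
    - by apply: measurable_funTS; apply/measurable_EFinP; exact: measurable_funB.
    - by move=> x _; rewrite lee_fin.
    - by apply: measurable_funTS; exact/measurable_EFinP.
  by rewrite -integral_cst//; apply/eqP/eq_integral => x _; rewrite -EFinD subrK.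
have [mE mfin] := intj m mm mitv; have [fjE fjfin] := intj fj mfj fjitv.
move: H; rewrite mE fjE leeD2lE; last by rewrite fin_numM// fin_num_measure.
rewrite leeN2 => /le_trans; apply.
under eq_integral do rewrite truncE//.
apply: ge0_le_integral => //.
- by move=> x _; rewrite le_min Y0 lee_fin ler0n.
- by apply: measurable_funTS; exact: measurable_mine.
- exact: measurable_funTS.
- by move=> x _; rewrite ge_min lexx.
Qed.

End nonnegative.
End birkhoff_limits.

(** * Versions of a conditional expectation *)

Section conditional_expectation.
Context d (T : measurableType d) (R : realType) (mu : probability T R).
Variable G : set (set T).
Hypothesis mG : forall A, G A -> measurable A.
Hypothesis GI : forall A B, G A -> G B -> G (A `&` B).

Lemma measure0_aeN (A : set T) : measurable A -> mu A = 0 ->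
  {ae mu, forall x, ~ A x}.
Proof. by move=> mA A0; exists A; split => // x /= /contrapT. Qed.

Lemma is_cond_exp_measurable f Y : is_cond_exp mu G f Y -> measurable_fun setT Y.
Proof. by move=> [GY _] _ B mB; rewrite setTI; exact/mG/GY. Qed.

(** The set where [Y] is negative belongs to [G]; the integral of [Y] over it is
    both nonnegative and minus the integral of [|Y|]. *)
Lemma is_cond_exp_ge0 f Y : (forall A, G A -> 0 <= \int[mu]_(x in A) f x) ->
  is_cond_exp mu G f Y -> {ae mu, forall x, 0 <= Y x}.
Proof.
move=> f0 fY; have mY := is_cond_exp_measurable fY; have [GY intY] := fY.
pose A := Y @^-1` `]-oo, 0[%classic.
have GA : G A by apply: GY; exact: emeasurable_itv.
have AY x : A x -> Y x < 0 by rewrite /A /= in_itv.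
have mA := mG GA.
have A0 : mu A = 0.
  have : \int[mu]_(x in A) `|Y x| = 0.
    have E : \int[mu]_(x in A) Y x = - \int[mu]_(x in A) `|Y x|.
      rewrite -integral_ge0N; last by move=> x _; exact: abse_ge0.
      apply: eq_integral => x /set_mem/AY Y0.
      by rewrite lte0_abs// oppeK.
    have := f0 A GA; rewrite -intY// E oppe_ge0 => H.
    by apply/eqP; rewrite eq_le H integral_ge0.
  move=> /(ae_eq_integral_abs _ mA (measurable_funTS mY)) [N [mN N0 AN]].
  apply: (subset_measure0 mA mN _ N0) => x Ax; apply: AN => /= H.
  by have := AY x Ax; rewrite H// ltxx.
have := measure0_aeN mA A0.
by apply: filterS => x; rewrite /A /= in_itv/= => /negP; rewrite -leNgt.
Qed.

(** Levels on grids make the pairs that separate two values countable. *)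
Lemma grid_between (x y : \bar R) : 0 <= x -> x < y ->
  exists k i : nat, x <= (i%:R / k.+1%:R)%:E /\ (i.+1%:R / k.+1%:R)%:E <= y.
Proof.
move=> x0 /ereal_dense[r /andP[xr /ereal_dense[s /andP[rs sy]]]].
have r0 : (0 <= r)%R by rewrite -lee_fin (le_trans x0)// ltW.
rewrite lte_fin in rs; have rs0 : (0 < s - r)%R by rewrite subr_gt0.
(* the mesh is less than half of the gap [s - r], so two grid points fit in it *)
pose k := Num.bound (2 / (s - r))%R; exists k, (Num.truncn (r * k.+1%:R)).+1.
have k0 : (0 < k.+1%:R :> R)%R by rewrite ltr0n.
have Hk : (2 < (s - r) * k.+1%:R)%R.
  rewrite mulrC -ltr_pdivrMr// (@lt_trans _ _ k%:R%R) ?ltr_nat//.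
  by apply: archi_boundP; rewrite divr_ge0// ltW.
have rk0 : (0 <= r * k.+1%:R)%R by rewrite mulr_ge0// ltW.
have /andP[t1 t2] := truncn_itv rk0.
split.
  apply: (le_trans (ltW xr)); rewrite lee_fin ler_pdivlMr//; exact: ltW.
apply: (le_trans _ (ltW sy)); rewrite lee_fin ler_pdivrMr//.
by rewrite -natr1 -natr1; move: Hk t1; rewrite mulrBl; lra.
Qed.

(** For levels [q < q'], the set where [Y1 <= q] and [q' <= Y2] belongs to [G] and
    both versions have the same integral over it, so it is null. Bounding [Y1]
    keeps these integrals finite although [f] may have infinite mean. *)
Lemma is_cond_exp_le f Y1 Y2 : (forall A, G A -> 0 <= \int[mu]_(x in A) f x) ->
  is_cond_exp mu G f Y1 -> is_cond_exp mu G f Y2 ->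
  {ae mu, forall x, Y2 x <= Y1 x}.
Proof.
move=> f0 fY1 fY2.
have mY1 := is_cond_exp_measurable fY1; have [GY1 intY1] := fY1.
have mY2 := is_cond_exp_measurable fY2; have [GY2 intY2] := fY2.
have H : {ae mu, forall x k i, ~ (0 <= Y1 x <= (i%:R / k.+1%:R)%:E /\
    (i.+1%:R / k.+1%:R)%:E <= Y2 x)}.
  apply: ae_foralln => k; apply: ae_foralln => i.
  set q : R := (i%:R / k.+1%:R)%R; set q' : R := (i.+1%:R / k.+1%:R)%R.
  have qq' : (q < q')%R by rewrite ltr_pM2r ?invr_gt0 ?ltr0n// ltr_nat.
  pose A := Y1 @^-1` `[0, q%:E]%classic `&` Y2 @^-1` `[q'%:E, +oo]%classic.
  have GA : G A by apply: GI; [apply: GY1|apply: GY2]; exact: emeasurable_itv.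
  have mA := mG GA.
  have A1 x : A x -> 0 <= Y1 x <= q%:E by move=> [+ _]; rewrite /= in_itv.
  have A2 x : A x -> q'%:E <= Y2 x by move=> [_ ]; rewrite /= in_itv/= leey andbT.
  have A0 : mu A = 0.
    have q'0 : (0 <= q')%R by rewrite divr_ge0.
    have : q'%:E * mu A <= q%:E * mu A.
      rewrite -!integral_cst//.
      apply: (@le_trans _ _ (\int[mu]_(x in A) Y2 x)).
        apply: ge0_le_integral => //; exact: measurable_funTS.
      rewrite intY2// -intY1//; apply: ge0_le_integral => //.
      - by move=> x /A1/andP[].
      - exact: measurable_funTS.
      - by move=> x /A1/andP[].
    have mufin : mu A \is a fin_num by exact: fin_num_measure.
    rewrite -(fineK mufin) -!EFinM lee_fin => Hle; congr EFin; apply/eqP.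
    rewrite eq_le fine_ge0// andbT leNgt; apply/negP => mu0.
    by move: Hle; rewrite ler_pM2r// leNgt qq'.
  have := measure0_aeN mA A0; apply: filterS => x NA [xa xb]; apply: NA.
  by split; rewrite /= in_itv/= ?leey ?andbT.
have H0 := is_cond_exp_ge0 f0 fY1.
apply: filterS2 H H0 => x Hx Y10; rewrite leNgt; apply/negP => Y12.
have [k [i [h1 h2]]] := grid_between Y10 Y12.
by apply: (Hx k i); rewrite Y10.
Qed.

Lemma is_cond_exp_unique f Y1 Y2 : (forall A, G A -> 0 <= \int[mu]_(x in A) f x) ->
  is_cond_exp mu G f Y1 -> is_cond_exp mu G f Y2 ->
  {ae mu, forall x, Y1 x = Y2 x}.
Proof.
move=> f0 fY1 fY2.
apply: filterS2 (is_cond_exp_le f0 fY1 fY2) (is_cond_exp_le f0 fY2 fY1) => x h1 h2.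
by apply/eqP; rewrite eq_le h1 h2.
Qed.

Lemma cond_exp_spec f Y : is_cond_exp mu G f Y -> is_cond_exp mu G f (cond_exp mu G f).
Proof. by move=> fY; apply: xgetPex; exists Y. Qed.

Lemma ae_integral_eq (f g : T -> \bar R) A : measurable A ->
  measurable_fun setT f -> measurable_fun setT g -> {ae mu, forall x, f x = g x} ->
  \int[mu]_(x in A) f x = \int[mu]_(x in A) g x.
Proof.
move=> mA mf mg fg; apply: ae_eq_integral => //; try exact: measurable_funTS.
by apply: filterS fg => x + _.
Qed.

End conditional_expectation.

(** * The pointwise ergodic theorem *)

Section birkhoff_theorem.
Context d (T : measurableType d) (R : realType) (mu : probability T R).
Variable th : T -> T.
Hypothesis mth : measurable_fun setT th.
Hypothesis mu_th : forall A, measurable A -> mu (th @^-1` A) = mu A.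

Let I := invariant_sets th.

Lemma invariant_sets_measurable A : I A -> measurable A.
Proof. by case. Qed.

Lemma invariant_setsI A B : I A -> I B -> I (A `&` B).
Proof.
move=> [mA Ath] [mB Bth]; split; first exact: measurableI.
by rewrite preimage_setI Ath Bth.
Qed.

Lemma invariant_sets_preimage (Y : T -> \bar R) B : measurable_fun setT Y ->
  (forall x, Y (th x) = Y x) -> measurable B -> I (Y @^-1` B).
Proof.
move=> mY Yth mB; split; first by rewrite -[_ @^-1` _]setTI; exact: mY.
by apply/seteqP; split => x /=; rewrite Yth.
Qed.

(** An invariant set is null or of full measure, so over it the integral of [f]
    is 0 or the whole integral, like the one of the constant. *)
Lemma ergodic_cond_exp (f : T -> \bar R) : ergodic_map mu th ->
  measurable_fun setT f -> {ae mu, forall x, 0 <= f x} ->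
  is_cond_exp mu I f (cst (\int[mu]_x f x)).
Proof.
move=> erg mf f0; split.
  by move=> B mB; apply: invariant_sets_preimage.
move=> A IA; have [mA Ath] := IA; rewrite integral_cst//.
have [A0|A1] := erg A IA.
  by rewrite [X in _ * X]A0 mule0 null_set_integral//; exact: measurable_funTS.
rewrite [X in _ * X]A1 mule1 [RHS]integral_mkcond; apply: ae_integral_eq => //.
  by apply/(measurable_restrictT _ _).1 => //; exact: measurable_funTS.
have CA0 : mu (~` A) = 0.
  by rewrite probability_setC// A1 subee.
have := measure0_aeN (measurableC mA) CA0.
by apply: filterS => x /contrapT Ax; rewrite patchE mem_set.
Qed.

Section nonnegative.
Variables (h : T -> \bar R) (f : T -> R).
Hypothesis mh : measurable_fun setT h.
Hypothesis mf : measurable_fun setT f.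
Hypothesis f0 : forall x, (0 <= f x)%R.
Hypothesis hf : {ae mu, forall x, h x = (f x)%:E}.

Let mfE : measurable_fun setT (EFin \o f).
Proof. exact/measurable_EFinP. Qed.

Lemma integral_invariant_ge0 A : I A -> 0 <= \int[mu]_(x in A) h x.
Proof.
move=> IA; rewrite (ae_integral_eq (invariant_sets_measurable IA) mh mfE hf).
by apply: integral_ge0 => x _; rewrite lee_fin.
Qed.

(** The chain int limsup <= int f <= int liminf <= int limsup collapses. *)
Lemma is_cond_exp_birkhoff :
  is_cond_exp mu I h (birkhoff_limsup th f) /\
  is_cond_exp mu I h (birkhoff_liminf th f).
Proof.
have main A : I A ->
    \int[mu]_(x in A) birkhoff_limsup th f x = \int[mu]_(x in A) (f x)%:E /\
    \int[mu]_(x in A) birkhoff_liminf th f x = \int[mu]_(x in A) (f x)%:E.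
  move=> IA; have [mA _] := IA.
  have h1 := integral_birkhoff_limsup_le mth mu_th mf f0 IA.
  have h2 := integral_le_birkhoff_liminf mth mu_th mf f0 IA.
  have h3 : \int[mu]_(x in A) birkhoff_liminf th f x <=
      \int[mu]_(x in A) birkhoff_limsup th f x.
    apply: ge0_le_integral => //.
    - by move=> x _; exact: birkhoff_liminf_ge0.
    - by apply: measurable_funTS; exact: measurable_birkhoff_liminf.
    - by apply: measurable_funTS; exact: measurable_birkhoff_limsup.
    - by move=> x _; exact: limn_einf_sup.
  split; apply/eqP; rewrite eq_le; apply/andP; split => //.
  - exact: le_trans h3.
  - exact: le_trans h1.
split; split.
- move=> B mB; apply: invariant_sets_preimage => //.
    exact: measurable_birkhoff_limsup.
  exact: birkhoff_limsup_invariant.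
- move=> A IA; rewrite (main A IA).1; apply/esym.
  exact: (ae_integral_eq (invariant_sets_measurable IA) mh mfE hf).
- move=> B mB; apply: invariant_sets_preimage => //.
    exact: measurable_birkhoff_liminf.
  exact: birkhoff_liminf_invariant.
- move=> A IA; rewrite (main A IA).2; apply/esym.
  exact: (ae_integral_eq (invariant_sets_measurable IA) mh mfE hf).
Qed.

Lemma is_cond_exp_invariant : is_cond_exp mu I h (cond_exp mu I h).
Proof. exact: (cond_exp_spec is_cond_exp_birkhoff.1). Qed.

Theorem birkhoff :
  {ae mu, forall x, birkhoff_mean th f n x @[n --> \oo] --> cond_exp mu I h x}.
Proof.
have [c1 c2] := is_cond_exp_birkhoff.
have u1 := is_cond_exp_unique invariant_sets_measurable invariant_setsI
  integral_invariant_ge0 c1 c2.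
have u2 := is_cond_exp_unique invariant_sets_measurable invariant_setsI
  integral_invariant_ge0 c1 is_cond_exp_invariant.
by apply: filterS2 u1 u2 => x e1 <-; exact: cvg_limn_esup_einf.
Qed.

Lemma ergodic_cond_expE : ergodic_map mu th ->
  {ae mu, forall x, cond_exp mu I h x = \int[mu]_y h y}.
Proof.
move=> erg; apply: (is_cond_exp_unique invariant_sets_measurable invariant_setsI
  integral_invariant_ge0 is_cond_exp_invariant).
apply: ergodic_cond_exp => //.
by apply: filterS hf => x ->; rewrite lee_fin.
Qed.

(** Over the invariant set where the conditional expectation vanishes, the
    integral of the positive function [h] is 0. *)
Lemma cond_exp_gt0 : {ae mu, forall x, 0 < h x} ->
  {ae mu, forall x, 0 < cond_exp mu I h x}.
Proof.
move=> h0; set Y := cond_exp mu I h.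
have cY : is_cond_exp mu I h Y := is_cond_exp_invariant.
have Y0 := is_cond_exp_ge0 invariant_sets_measurable integral_invariant_ge0 cY.
pose A := Y @^-1` [set 0]; have IA : I A by apply: cY.1; exact: emeasurable_set1.
have [mA _] := IA.
have A0 : mu A = 0.
  have : \int[mu]_(x in A) `|h x| = 0.
    rewrite -[RHS](@integral0_eq _ _ _ mu A Y)//.
    rewrite cY.2//; apply: ae_integral_eq => //; first exact: measurableT_comp.
    by apply: filterS h0 => x /ltW/gee0_abs.
  move=> /(ae_eq_integral_abs _ mA (measurable_funTS mh)) hA.
  have [N [mN N0 AN]] : {ae mu, forall x, ~ A x}.
    by apply: filterS2 hA h0 => x hx0 hx Ax; move: hx; rewrite hx0// ltxx.
  apply: (subset_measure0 mA mN _ N0) => x Ax; exact: AN.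
apply: filterS2 Y0 (measure0_aeN mA A0) => x Y0 NA.
by rewrite lt0e Y0 andbT; apply/eqP.
Qed.

Lemma cond_exp_ltoo : \int[mu]_x h x < +oo ->
  {ae mu, forall x, cond_exp mu I h x < +oo}.
Proof.
move=> hoo; set Y := cond_exp mu I h.
have cY : is_cond_exp mu I h Y := is_cond_exp_invariant.
have IT : I setT by split.
pose A := Y @^-1` [set +oo]; have IA : I A by apply: cY.1; exact: emeasurable_set1.
have [mA _] := IA.
have A0 : mu A = 0.
  apply/eqP; apply: contraT => A0; have : 0 < mu A by rewrite lt0e A0 measure_ge0.
  move=> Apos.
  have : +oo * mu A <= \int[mu]_x h x.
    rewrite -integral_cst//.
    have -> : \int[mu]_(x in A) cst +oo x = \int[mu]_(x in A) Y x.
      by apply: eq_integral => x /set_mem.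
    rewrite cY.2// (ae_integral_eq mA mh mfE hf) (ae_integral_eq measurableT mh mfE hf).
    by apply: ge0_subset_integral => //; move=> x _; rewrite lee_fin.
  by rewrite gt0_mulye// leye_eq => /eqP hE; move: hoo; rewrite hE ltxx.
apply: filterS (measure0_aeN mA A0) => x NA.
by rewrite ltey; apply/eqP.
Qed.

End nonnegative.
End birkhoff_theorem.

(** * Configurations, shifts and relabellings *)

Section configurations.
Variable R : realType.
Implicit Types (m : config R).

Lemma measurable_coord (n : int) : measurable_fun setT (fun m : config R => m n).
Proof.
move=> _ B mB; apply: sub_sigma_algebra; exists n => //.
by exists B.
Qed.

Lemma measurable_X (n : int) : measurable_fun setT (@X R n).
Proof. exact: (measurableT_comp measurable_fst (measurable_coord n)). Qed.

Lemma measurable_K (n : int) : measurable_fun setT (@K R n).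
Proof. exact: (measurableT_comp measurable_snd (measurable_coord n)). Qed.

Lemma measurable_mark (i : nat) :
  measurable_fun setT (fun k : marks R => ((k : mark_seq R) i)%:num%R).
Proof.
move=> _ B mB; apply: sub_sigma_algebra; exists i => //.
by exists B.
Qed.

Lemma measurable_L (n : int) (i : nat) : measurable_fun setT (@L R n i).
Proof. exact: (measurableT_comp (measurable_mark i) (measurable_K n)). Qed.

Lemma measurable_D (n : int) : measurable_fun setT (@D R n).
Proof. by apply: measurable_funB; exact: measurable_X. Qed.

Lemma measurable_to_config d (T : measurableType d) (f : T -> config R) :
  (forall n, measurable_fun setT (fun t => X n (f t))) ->
  (forall n, measurable_fun setT (fun t => K n (f t))) ->
  measurable_fun setT f.
Proof.
move=> mX mK.
refine (@measurability _ _ T (config R) setT f (@config_cylinders R) erefl _).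
move=> _ [_ [n _ [B mB <-]] <-]; rewrite !setTI.
have mn : measurable_fun setT (fun t => f t n).
  rewrite [X in measurable_fun _ X](_ : _ = (fun t => (X n (f t), K n (f t)))).
    exact: measurable_fun_pair.
  by apply/funext => t; rewrite /X /K; case: (f t n).
by have := mn measurableT B mB; rewrite setTI.
Qed.

Lemma measurable_recenter (n : int) : measurable_fun setT (@recenter R n).
Proof.
apply: measurable_to_config => k.
  by apply: measurable_funB; exact: measurable_X.
exact: measurable_K.
Qed.

Lemma measurable_shift : measurable_fun setT (@shift R).
Proof. exact: measurable_recenter. Qed.

Lemma config_eq m m' : (forall n, X n m = X n m') -> (forall n, K n m = K n m') ->
  m = m'.
Proof.
move=> eX eK; apply/funext => n; have := eX n; have := eK n; rewrite /X /K.
by case: (m n) (m' n) => [x k] [x' k'] /= -> ->.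
Qed.

Lemma X_recenter (k n : int) m : X k (recenter n m) = (X (n + k)%R m - X n m)%R.
Proof. by []. Qed.

Lemma K_recenter (k n : int) m : K k (recenter n m) = K (n + k)%R m.
Proof. by []. Qed.

Lemma recenter_recenter (k n : int) m :
  recenter k (recenter n m) = recenter (n + k)%R m.
Proof.
apply: config_eq => j; last by rewrite !K_recenter addrA.
by rewrite !X_recenter opprB addrA subrK addrA.
Qed.

Lemma D_recenter (k n : int) m : D k (recenter n m) = D (n + k)%R m.
Proof. by rewrite /D !X_recenter opprB addrA subrK addrA. Qed.

Lemma TR_recenter (k n : int) m : TR k (recenter n m) = TR (n + k)%R m.
Proof.
rewrite /TR /tau D_recenter; congr (_ + _).
Qed.

Lemma D_iter_shift n m : D n%:Z m = D 0%R (iter n (@shift R) m).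
Proof.
suff H k : D k (iter n (@shift R) m) = D (n%:Z + k)%R m by rewrite H addr0.
elim: n k => [|n IH] k; first by rewrite add0r.
by rewrite iterS D_recenter IH addrA -addn1 PoszD.
Qed.

Lemma TR_iter_shift n m : TR n%:Z m = TR 0%R (iter n (@shift R) m).
Proof.
suff H k : TR k (iter n (@shift R) m) = TR (n%:Z + k)%R m by rewrite H addr0.
elim: n k => [|n IH] k; first by rewrite add0r.
by rewrite iterS TR_recenter IH addrA -addn1 PoszD.
Qed.

Definition int_enum (n : nat) : int := if odd n then Negz n./2 else Posz n./2.

Lemma int_enum_bij : set_bij [set: nat] [set: int] int_enum.
Proof.
split => //.
- move=> i j _ _ H; rewrite -(odd_double_half i) -(odd_double_half j); move: H.
  by rewrite /int_enum; case: (odd i); case: (odd j) => //= -[->].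
- move=> [k|k] _.
    by exists k.*2 => //; rewrite /int_enum odd_double doubleK.
  exists k.*2.+1 => //; rewrite /int_enum /= odd_double/=.
  by rewrite uphalf_double.
Qed.

(** Sums over the integers are countable series, which [int_enum] makes explicit. *)
Lemma measurable_esum_int d (T : measurableType d) (a : int -> T -> \bar R) :
  (forall n x, 0 <= a n x) -> (forall n, measurable_fun setT (a n)) ->
  measurable_fun setT (fun x => \esum_(n in [set: int]) a n x).
Proof.
move=> a0 ma.
rewrite [X in measurable_fun _ X](_ : _ =
    (fun x => \sum_(0 <= i <oo | i \in predT) a (int_enum i) x)).
  by apply: ge0_emeasurable_sum.
apply/funext => x; rewrite (reindex_esum _ _ _ (a ^~ x) int_enum_bij).
by rewrite -nneseries_esumT.
Qed.

Section point_sequence.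
Variable m : config R.
Hypothesis pm : is_point_sequence m.

Lemma X_lt (i j : int) : (i < j)%R -> (X i m < X j m)%R.
Proof.
have [Xlt _ _] := pm.
have H k : (X i m < X (i + k.+1%:Z)%R m)%R.
  elim: k => [|k IH]; first exact: Xlt.
  by apply: (lt_trans IH); rewrite -[k.+2]addn1 PoszD addrA; exact: Xlt.
move=> ij; have -> : j = (i + (absz (j - i)%R).-1.+1%:Z)%R by lia.
exact: H.
Qed.

Lemma X_lt_iff (i j : int) : (X i m < X j m)%R = (i < j)%R.
Proof.
apply/idP/idP; last exact: X_lt.
by apply: contraTT; rewrite -!leNgt le_eqVlt => /predU1P[-> //|/X_lt/ltW].
Qed.

Lemma X_inj (i j : int) : X i m = X j m -> i = j.
Proof.
move=> H; apply/eqP; rewrite eq_le !leNgt -!X_lt_iff H ltxx.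
by [].
Qed.

Lemma point_count1 (k : int) (B : set (marks R)) :
  point_count m ([set X k m] `*` B) = (\1_B (K k m))%:E.
Proof.
rewrite /point_count (esum_mkcond [set: int]).
rewrite (_ : (fun n => _) = (fun n => if n \in [set k] then
   (\1_([set X k m] `*` B) (m n))%:E else 0)).
  rewrite -esum_mkcond esum_set1 ?lee_fin//.
  congr EFin; rewrite !indicE; congr (_%:R); congr nat_of_bool.
  by apply/idP/idP => /set_mem; [case=> _ ?|move=> ?]; apply/mem_set => //; split.
apply/funext => n; rewrite in_setT; case: ifPn => //.
rewrite notin_setE /= => nk; rewrite indicE memNset//.
by move=> [/= /X_inj].
Qed.

End point_sequence.

Lemma shift_singleton (t x : R) : [set (y + t)%R | y in [set x]] = [set (x + t)%R].
Proof. by rewrite image_set1. Qed.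

(** Counting the points in singletons shows that the two sets of points are
    translates of each other; two strictly increasing enumerations of one set
    indexed by the integers differ by a shift of the index. Counting over a
    singleton times a set of marks then identifies the marks, since the
    coordinates separate them. *)
Lemma relabel m m' (t : R) : is_point_sequence m -> is_point_sequence m' ->
  (forall C B, measurable C -> measurable B ->
    point_count m' (C `*` B) = point_count m ([set (x + t)%R | x in C] `*` B)) ->
  exists k : int, forall n, X n m' = (X (n + k)%R m - t)%R /\ K n m' = K (n + k)%R m.
Proof.
move=> pm pm' H.
have sub1 i : exists j, (X i m' + t)%R = X j m.
  apply: contrapT => Hj.
  have := H [set X i m'] setT (measurable_set1 _) measurableT.
  rewrite point_count1// indicT shift_singleton /point_count esum1.
    by move=> [/eqP]; rewrite oner_eq0.
  move=> n _; rewrite indicE memNset// => -[/= E _]; apply: Hj; exists n.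
  by rewrite -E.
have sub2 j : exists i, (X i m' + t)%R = X j m.
  apply: contrapT => Hj.
  have := H [set (X j m - t)%R] setT (measurable_set1 _) measurableT.
  rewrite shift_singleton subrK point_count1// indicT /point_count esum1.
    by move=> [/esym/eqP]; rewrite oner_eq0.
  move=> n _; rewrite indicE memNset// => -[/= E _]; apply: Hj; exists n.
  by rewrite /X E subrK.
(* the matching of the points commutes with successors and predecessors *)
have [k Hk] := sub1 0%R.
have up i j : (X i m' + t)%R = X j m -> (X (i + 1)%R m' + t)%R = X (j + 1)%R m.
  move=> ij; have [j' ij'] := sub1 (i + 1)%R; have [i' ji'] := sub2 (j + 1)%R.
  have h1 : (j < j')%R by rewrite -(X_lt_iff pm) -ij -ij' ltrD2r X_lt_iff//; lia.
  have h2 : (i < i')%R by rewrite -(X_lt_iff pm') -(ltrD2r t) ij ji' X_lt_iff//; lia.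
  have [jj|jj] := eqVneq j' (j + 1)%R; first by rewrite ij' jj.
  have : (j + 1 < j')%R by lia.
  rewrite -(X_lt_iff pm) -ij' -ji' ltrD2r X_lt_iff//; lia.
have down i j : (X i m' + t)%R = X j m -> (X (i - 1)%R m' + t)%R = X (j - 1)%R m.
  move=> ij; have [j' ij'] := sub1 (i - 1)%R; have [i' ji'] := sub2 (j - 1)%R.
  have h1 : (j' < j)%R by rewrite -(X_lt_iff pm) -ij -ij' ltrD2r X_lt_iff//; lia.
  have h2 : (i' < i)%R by rewrite -(X_lt_iff pm') -(ltrD2r t) ij ji' X_lt_iff//; lia.
  have [jj|jj] := eqVneq j' (j - 1)%R; first by rewrite ij' jj.
  have : (j' < j - 1)%R by lia.
  rewrite -(X_lt_iff pm) -ij' -ji' ltrD2r X_lt_iff//; lia.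
have XE n : (X n m' + t)%R = X (n + k)%R m.
  case: n => n.
    elim: n => [|n IH]; first by rewrite add0r.
    by rewrite -[n.+1]addn1 PoszD addrAC; exact: up.
  rewrite NegzE; elim: n => [|n IH].
    by have := down _ _ Hk; rewrite sub0r [(k - 1)%R]addrC.
  have -> : (- n.+2%:Z = - n.+1%:Z - 1 :> int)%R by lia.
  by rewrite addrAC; exact: down.
exists k => n; split; first by rewrite -XE addrK.
apply/funext => i; apply: val_inj => /=.
have := H [set X n m'] ((fun k : marks R => ((k : mark_seq R) i)%:num%R) @^-1`
  [set L n i m']) (measurable_set1 _).
rewrite shift_singleton XE !point_count1// => HK.
have mB : measurable ((fun k : marks R => ((k : mark_seq R) i)%:num%R) @^-1`
    [set L n i m']).
  by rewrite -[_ @^-1` _]setTI; apply: measurable_mark => //; exact: measurable_set1.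
have := HK mB; rewrite indicE mem_set// => -[].
rewrite indicE; case: (boolP (_ \in _)) => [/set_mem /= ->//|_ /eqP].
by rewrite oner_eq0.
Qed.

End configurations.

(** * Palm probability and its invariance *)

Section palm.
Context d (Omega : measurableType d) (R : realType) (P : probability Omega R).
Variable Phi : Omega -> config R.
Variable P0 : probability (config R) R.
Hypothesis Phi_mpp : marked_point_process Phi.
Hypothesis intensity_gt0 : 0 < intensity P Phi.
Hypothesis intensity_ltoo : intensity P Phi < +oo.
Hypothesis P0_palm : is_palm P Phi P0.

Let lam := fine (intensity P Phi).

Let lam_gt0 : (0 < lam)%R.
Proof. by apply: fine_gt0; rewrite intensity_gt0 intensity_ltoo. Qed.

Let mPhi : measurable_fun setT Phi. Proof. exact: Phi_mpp.1. Qed.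

Let Phi_points w : is_point_sequence (Phi w). Proof. exact: Phi_mpp.2. Qed.

Definition palm_sum (A : set (config R)) (B : set R) w : \bar R :=
  \esum_(n in [set: int]) (\1_B (X n (Phi w)) * \1_A (recenter n (Phi w)))%:E.

Lemma measurable_recenter_Phi n : measurable_fun setT (fun w => recenter n (Phi w)).
Proof. exact: (measurableT_comp (measurable_recenter n) mPhi). Qed.

Lemma measurable_X_Phi n : measurable_fun setT (fun w => X n (Phi w)).
Proof. exact: (measurableT_comp (measurable_X n) mPhi). Qed.

Lemma palm_sum_ge0 A B w : 0 <= palm_sum A B w.
Proof. by apply: esum_ge0 => n _; rewrite lee_fin mulr_ge0. Qed.

Lemma measurable_palm_sum A B : measurable A -> measurable B ->
  measurable_fun setT (palm_sum A B).
Proof.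
move=> mA mB; apply: measurable_esum_int => [n x|n].
  by rewrite lee_fin mulr_ge0.
have m1 : measurable_fun setT (\1_B : R -> R) by exact: measurable_indic.
have m2 : measurable_fun setT (\1_A : config R -> R) by exact: measurable_indic.
apply/measurable_EFinP; apply: measurable_funM.
- exact: (measurableT_comp m1 (measurable_X_Phi n)).
- exact: (measurableT_comp m2 (measurable_recenter_Phi n)).
Qed.

Lemma palm_itv A (a b : R) : measurable A -> (a < b)%R ->
  P0 A = (lam * (b - a))^-1%:E * \int[P]_w palm_sum A `[a, b]%classic w.
Proof.
move=> mA ab.
have mab : measurable (`[a, b]%classic : set R) by exact: measurable_itv.
have lab : lebesgue_measure (`[a, b]%classic : set R) = (b - a)%:E.
  by rewrite lebesgue_measure_itv /= lte_fin ab.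
rewrite (P0_palm mA mab) lab ?lte_fin ?subr_gt0 ?ltry//.
congr (_ * _); rewrite -[intensity P Phi]fineK; last first.
  by rewrite ge0_fin_numE// ltW.
by rewrite -EFinM inver gt_eqF// mulr_gt0// subr_gt0.
Qed.

(** The Palm sum of [A] vanishes off the null set [N]. *)
Lemma palm_null A (N : set Omega) : measurable A -> measurable N -> P N = 0 ->
  (forall w n, A (recenter n (Phi w)) -> N w) -> P0 A = 0.
Proof.
move=> mA mN N0 AN; rewrite (palm_itv mA ltr01).
rewrite (@ae_integral_eq _ _ _ P _ (cst 0) setT) ?integral0 ?mule0//.
- by apply: measurable_palm_sum => //; exact: measurable_itv.
- apply: filterS (measure0_aeN mN N0) => w Nw.
  rewrite /palm_sum esum1// => n _; rewrite [X in (_ * X)%R]indicE memNset ?mulr0//.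
  by move=> /AN.
Qed.

(** On [N] every point contributes to the Palm sum, so the part of [N] where the
    point number 0 lies in a bounded interval has probability at most the
    expectation of the sum, which is 0; such parts exhaust [N]. *)
Lemma palm_null_inv A (N : set Omega) : measurable A -> measurable N -> P0 A = 0 ->
  (forall w n, N w -> A (recenter n (Phi w))) -> P N = 0.
Proof.
move=> mA mN A0 NA.
pose B (j : nat) : set R := `[(- j.+1%:R)%R, j.+1%:R%R]%classic.
have mB j : measurable (B j) by exact: measurable_itv.
pose F j := N `&` [set w | B j (X 0 (Phi w))].
have mF j : measurable (F j).
  apply: measurableI => //; rewrite -[X in measurable X]setTI.
  exact: measurable_X_Phi.
have F0 j : P (F j) = 0.
  have jj : (- j.+1%:R < j.+1%:R :> R)%R by rewrite gtrN// ltr0n.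
  have I0 : \int[P]_w palm_sum A (B j) w = 0.
    move: A0; rewrite (palm_itv mA jj) => /eqP; rewrite mule_eq0 => /orP[|/eqP//].
    by rewrite eqe invr_eq0 mulf_eq0 !gt_eqF// subr_gt0.
  apply/eqP; rewrite eq_le measure_ge0 andbT -I0.
  have -> : P (F j) = \int[P]_w (\1_(F j) w)%:E by rewrite integral_indic// setIT.
  apply: ge0_le_integral => //.
  - by apply/measurable_EFinP; exact: measurable_indic.
  - exact: measurable_palm_sum.
  - move=> w _; rewrite indicE.
    case: (boolP (w \in F j)) => [/set_mem[Nw Bw]|_]; last first.
      exact: palm_sum_ge0.
    apply: esum_ge; exists [set 0%R : int].
      by split => //; exact: finite_set1.
    by rewrite fsbig_set1 !indicE !mem_set ?mulr1//; exact: NA.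
have : P.-negligible (\bigcup_j F j).
  apply: negligible_bigcup => j; exists (F j). split. exact: mF. exact: F0. by [].
have -> : \bigcup_j F j = N.
  apply/seteqP; split => [w [j _ []]//|w Nw].
  exists (Num.bound `|X 0 (Phi w)|%R) => //; split => //=.
  rewrite /B /= in_itv/= -ler_norml (@le_trans _ _ (Num.bound `|X 0 (Phi w)|%R)%:R%R)//.
    by apply/ltW/archi_boundP.
  by rewrite ler_nat.
exact: measure_negligible.
Qed.

Lemma palm_ae (Q : set (config R)) : measurable Q ->
  (forall w n, Q (recenter n (Phi w))) -> {ae P0, forall m, Q m}.
Proof.
move=> mQ HQ.
have : P0 (~` Q) = 0.
  by apply: (@palm_null _ set0 (measurableC mQ)) => // w n; exact.
move=> /(measure0_aeN (measurableC mQ)).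
by apply: filterS => m /contrapT.
Qed.

(** Increasing points cross the level [c] at most once. *)
Lemma esum_crossing (c : R) w :
  \esum_(n in [set: int])
    (((X n (Phi w) <= c) && (c < X (n + 1) (Phi w)))%R%:R : R)%:E <= 1.
Proof.
set a := fun n : int => _.
have a01 n : 0 <= a n <= 1 by rewrite /a !lee_fin ler0n/= lern1 leq_b1.
have [[n0 Hn0]|H] := pselect (exists n0, (X n0 (Phi w) <= c < X (n0 + 1) (Phi w))%R).
  rewrite (_ : \esum_(n in _) _ = \esum_(n in [set n0]) a n).
    by rewrite esum_set1; have /andP[] := a01 n0.
  rewrite [RHS]esum_mkcond; apply: eq_esum => n _; case: ifPn => // /negP nn0.
  rewrite /a; case: (boolP (_ && _)) => // /andP[h1 h2]; exfalso; apply: nn0.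
  apply/mem_set => /=; move: Hn0 => /andP[h3 h4].
  have := le_lt_trans h1 h4; have := le_lt_trans h3 h2.
  by rewrite !X_lt_iff//; lia.
rewrite esum1// => n _; case: (boolP (_ && _)) => // Hn.
by exfalso; apply: H; exists n.
Qed.

(** Shifting replaces the condition on [X n] by the one on [X (n + 1)]; this only
    matters for the point that is the last one before [c]. *)
Lemma palm_sum_shift A (c : R) w : (0 < c)%R ->
  palm_sum (@shift R @^-1` A) `[0%R, c]%classic w <=
  palm_sum A `[0%R, c]%classic w + 1.
Proof.
move=> c0.
have -> : palm_sum A `[0%R, c]%classic w = \esum_(n in [set: int])
    (\1_`[0%R, c]%classic (X (n + 1) (Phi w)) * \1_A (recenter (n + 1) (Phi w)))%R%:E.
  apply: reindex_esum; split => //.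
  - by move=> i j _ _; exact: addIr.
  - by move=> j _; exists (j - 1)%R => //; rewrite subrK.
apply: le_trans (leeD2l _ (esum_crossing c w)).
rewrite -esumD; last 2 first.
- by move=> n _; rewrite lee_fin mulr_ge0.
- by move=> n _; rewrite lee_fin.
apply: le_esum => n _; rewrite -EFinD lee_fin.
have -> : \1_(@shift R @^-1` A) (recenter n (Phi w)) =
    \1_A (recenter (n + 1) (Phi w)) :> R.
  by rewrite !indicE -recenter_recenter.
have [] := boolP (X n (Phi w) \in `[0%R, c]%classic); last first.
  by move=> h; rewrite [X in (X * _)%R]indicE (negbTE h) mul0r addr_ge0// mulr_ge0.
move=> /[dup] h /set_mem /=; rewrite in_itv/= => /andP[h0 hc].
have lt1 : (X n (Phi w) < X (n + 1) (Phi w))%R by rewrite X_lt_iff//; lia.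
rewrite [X in (X * _ <= _)%R]indicE h mul1r hc /=.
have [h1|h1] := leP (X (n + 1) (Phi w)) c.
  rewrite addr0 [X in (_ <= X * _)%R]indicE mem_set ?mul1r//=.
  by rewrite in_itv/= h1 (le_trans h0)// ltW.
apply: (@le_trans _ _ 1%R); last by rewrite lerDr mulr_ge0.
by rewrite indicE; case: (_ \in _).
Qed.

(** The boundary point contributes at most 1 to a Palm sum over [[0, c]], that is
    [1 / (lam * c)] to the Palm probability; [c] is arbitrarily large. *)
Lemma palm_shift_le A : measurable A -> P0 (@shift R @^-1` A) <= P0 A.
Proof.
move=> mA; have mSA : measurable (@shift R @^-1` A).
  by rewrite -[X in measurable X]setTI; exact: measurable_shift.
have H j : P0 (@shift R @^-1` A) <= P0 A + (lam * j.+1%:R)^-1%:E.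
  have j0 : (0 < j.+1%:R :> R)%R by rewrite ltr0n.
  rewrite (palm_itv mA j0) (palm_itv mSA j0) !subr0.
  set k := (lam * j.+1%:R)^-1%R.
  have k0 : (0 <= k)%R by rewrite invr_ge0 mulr_ge0// ltW.
  have mP B : measurable B ->
      measurable_fun setT (palm_sum B `[0%R, j.+1%:R : R]%classic).
    by move=> mB; apply: measurable_palm_sum => //; exact: measurable_itv.
  rewrite -[X in _ <= _ + X]mule1 -ge0_muleDr//; last first.
    by apply: integral_ge0 => w _; exact: palm_sum_ge0.
  apply: lee_wpmul2l; first by rewrite lee_fin.
  have -> : \int[P]_w palm_sum A `[0%R, j.+1%:R]%classic w + 1 =
      \int[P]_w (palm_sum A `[0%R, j.+1%:R]%classic w + 1).
    rewrite ge0_integralD//; last 2 first.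
    - by move=> w _; exact: palm_sum_ge0.
    - exact: mP.
    by rewrite integral_cst// mul1e [X in _ = _ + X]probability_setT.
  apply: ge0_le_integral => //.
  - by move=> w _; exact: palm_sum_ge0.
  - exact: mP.
  - by apply: emeasurable_funD => //; exact: mP.
  - by move=> w _; exact: palm_sum_shift.
apply/lee_addgt0Pr => e e0.
apply: (le_trans (H (Num.bound (lam * e)^-1))); rewrite leeD2l// lee_fin.
have le0 : (0 < lam * e)%R by rewrite mulr_gt0.
set n := Num.bound _.
have : ((lam * e)^-1 < n.+1%:R)%R.
  apply: (@lt_trans _ _ n%:R%R); last by rewrite ltr_nat.
  by apply: archi_boundP; rewrite invr_ge0 ltW.
rewrite -[((lam * e)^-1)%R]mul1r ltr_pdivrMr// => h.
by rewrite -[leLHS]mul1r ler_pdivrMr ?mulr_gt0//; lra.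
Qed.

(** The inequality for the complement is the reverse one. *)
Lemma palm_shift A : measurable A -> P0 (@shift R @^-1` A) = P0 A.
Proof.
move=> mA; apply/eqP; rewrite eq_le palm_shift_le//=.
have mSA : measurable (@shift R @^-1` A).
  by rewrite -[X in measurable X]setTI; exact: measurable_shift.
have := palm_shift_le (measurableC mA).
rewrite preimage_setC !probability_setC//.
by rewrite leeD2lE// leeN2.
Qed.

End palm.

(** * Ergodicity of the flow and of the shift *)

Section ergodicity.
Context d (Omega : measurableType d) (R : realType) (P : probability Omega R).
Variables (theta : R -> Omega -> Omega) (Phi : Omega -> config R).
Variable P0 : probability (config R) R.
Hypothesis Phi_mpp : marked_point_process Phi.
Hypothesis Phi_stationary : stationary P theta Phi.
Hypothesis intensity_gt0 : 0 < intensity P Phi.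
Hypothesis intensity_ltoo : intensity P Phi < +oo.
Hypothesis P0_palm : is_palm P Phi P0.

Lemma flow_relabel t w : exists k : int, forall n,
  X n (Phi (theta t w)) = (X (n + k)%R (Phi w) - t)%R /\
  K n (Phi (theta t w)) = K (n + k)%R (Phi w).
Proof.
apply: relabel; [exact: Phi_mpp.2|exact: Phi_mpp.2|].
exact: Phi_stationary.2.
Qed.

(** Shifting goes from a point to the next one; as the set equals its preimage,
    membership propagates in both directions, hence to the points of negative
    index as well. *)
Lemma recenter_invariant A (n : int) (m : config R) : invariant_sets (@shift R) A ->
  A (recenter n m) = A (recenter 0%R m).
Proof.
move=> [_ AS].
have up k : A (recenter (k + 1)%R m) = A (recenter k m).
  by rewrite -recenter_recenter -[in RHS]AS.
case: n => n.
  by elim: n => // n IH; rewrite -[n.+1]addn1 PoszD up.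
rewrite NegzE; elim: n => [|n IH]; first by rewrite -up addNr.
by rewrite -IH -up; congr (A (recenter _ m)); lia.
Qed.

Lemma probability_setC_eq1 d' (T : measurableType d') (Q : probability T R) A :
  measurable A -> Q (~` A) = 0 -> Q A = 1.
Proof.
move=> mA A0; rewrite -[A]setCK probability_setC ?A0 ?sube0//.
exact: measurableC.
Qed.

Lemma probability_setC_eq0 d' (T : measurableType d') (Q : probability T R) A :
  measurable A -> Q A = 1 -> Q (~` A) = 0.
Proof. by move=> mA A1; rewrite probability_setC// A1 subee. Qed.

(** The flow only relabels the recentred configurations, so the event that they
    lie in [A] is flow-invariant. *)
Lemma ergodic_flow_map : ergodic_flow P theta -> ergodic_map P0 (@shift R).
Proof.
move=> erg A IA; have [mA AS] := IA.
pose N := [set w | A (recenter 0%R (Phi w))].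
have mN : measurable N.
  by rewrite -[N]setTI; apply: (measurable_recenter_Phi Phi_mpp).
have Nth t : theta t @^-1` N = N.
  have rk w : exists k, recenter 0%R (Phi (theta t w)) = recenter k (Phi w).
    have [k Hk] := flow_relabel t w; exists k.
    apply: config_eq => j; rewrite ?X_recenter ?K_recenter !add0r.
      by rewrite (Hk j).1 (Hk 0%R).1 add0r [(k + j)%R]addrC; ring.
    by rewrite (Hk j).2 addrC.
  apply/seteqP; split => w; rewrite /N /=; have [k ->] := rk w;
    by rewrite recenter_invariant.
have [N0|N1] := erg N mN Nth.
- left; apply: (palm_null Phi_mpp intensity_gt0 intensity_ltoo P0_palm mA mN N0) => w n.
  by rewrite recenter_invariant.
- right; apply: probability_setC_eq1 => //.
  apply: (palm_null Phi_mpp intensity_gt0 intensity_ltoo P0_palm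
    (measurableC mA) (measurableC mN) (probability_setC_eq0 mN N1)) => w n.
  by rewrite /setC /= recenter_invariant.
Qed.

(** The view from halfway between the points 0 and 1 of a configuration whose
    point 0 is at the origin. Seen from a point, a configuration admits two
    labellings (the point at the origin may be number 0 or number 1); seen from
    here it admits one. *)
Definition midpoint_view (m : config R) : config R :=
  fun n => ((X n m - X 1%R m / 2)%R, K n m).

Lemma measurable_midpoint_view : measurable_fun setT midpoint_view.
Proof.
apply: measurable_to_config => n; last exact: measurable_K.
apply: measurable_funB; first exact: measurable_X.
by apply: measurable_funM => //; exact: measurable_X.
Qed.

(** No point sits at the midpoint, hence the labelling conventions determine the
    configuration seen from there. *)
Lemma flow_midpoint (n : int) w :
  Phi (theta ((X n (Phi w) + X (n + 1) (Phi w)) / 2)%R w) =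
  midpoint_view (recenter n (Phi w)).
Proof.
set t := (_ / _)%R; have [k Hk] := flow_relabel t w.
have pw : is_point_sequence (Phi w) := Phi_mpp.2 w.
have [_ /andP[x0 x1] _] := Phi_mpp.2 (theta t w).
have X01 : (X n (Phi w) < X (n + 1) (Phi w))%R by rewrite X_lt_iff//; lia.
(* both labellings put the origin between their points 0 and 1 *)
have nk : k = n.
  move: x0 x1; rewrite (Hk 0%R).1 (Hk 1%R).1 add0r subr_le0 subr_ge0 => x0 x1.
  have h1 : (X k (Phi w) < X (n + 1) (Phi w))%R.
    by apply: (le_lt_trans x0); rewrite /t; lra.
  have h2 : (X n (Phi w) < X (1 + k) (Phi w))%R.
    by apply: lt_le_trans x1; rewrite /t; lra.
  by move: h1 h2; rewrite !X_lt_iff//; lia.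
apply: config_eq => j; last by rewrite (Hk j).2 nk [X in _ = X]/K/= K_recenter addrC.
rewrite (Hk j).1 nk [X in _ = X]/X/= !X_recenter [(j + n)%R]addrC /t; lra.
Qed.

(** A flow-invariant event can be tested after moving the origin to the midpoint
    following any point. Requiring the test at all points makes the resulting
    set exactly shift-invariant. *)
Lemma generated_invariant_shift (A : set Omega) (C : set (config R)) : measurable C ->
  A = Phi @^-1` C -> (forall t, theta t @^-1` A = A) ->
  exists2 C' : set (config R), invariant_sets (@shift R) C' &
    forall w n, C' (recenter n (Phi w)) <-> A w.
Proof.
move=> mC AC Ath.
pose h (n : int) (m : config R) := midpoint_view (recenter n m).
have mh n : measurable_fun setT (h n).
  exact: (measurableT_comp measurable_midpoint_view (measurable_recenter n)).
pose C' := \bigcap_i (h (int_enum i) @^-1` C).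
have C'E m : C' m <-> forall n, C (h n m).
  split=> [H n|H i _]; last exact: H.
  have [_ _ /(_ n Logic.I)[i _ <-]] := int_enum_bij; exact: H.
exists C'.
  split.
    apply: bigcapT_measurable => i; rewrite -[X in measurable X]setTI.
    exact: mh.
  apply/seteqP; split => m /=; rewrite !C'E => H n.
    by have := H (n - 1)%R; rewrite /h recenter_recenter addrC subrK.
  by rewrite /h recenter_recenter; exact: H.
move=> w n; rewrite C'E.
have key k : C (h k (recenter n (Phi w))) = A w.
  rewrite /h recenter_recenter -flow_midpoint.
  by rewrite -[in RHS](Ath ((X (n + k) (Phi w) + X (n + k + 1) (Phi w)) / 2)%R) AC.
split=> [H|Aw k]; last by rewrite key.
by rewrite -(key 0%R); exact: H.
Qed.

Lemma ergodic_map_flow : generated_by Phi -> ergodic_map P0 (@shift R) ->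
  ergodic_flow P theta.
Proof.
move=> gen erg A mA Ath; have [C mC AC] := gen A mA.
have [C' IC' HC'] := generated_invariant_shift mC AC Ath.
have [mC' _] := IC'.
have [C0|C1] := erg C' IC'.
- left; apply: (palm_null_inv Phi_mpp intensity_gt0 intensity_ltoo P0_palm mC' mA C0).
  by move=> w n; rewrite HC'.
- right; apply: probability_setC_eq1 => //.
  apply: (palm_null_inv Phi_mpp intensity_gt0 intensity_ltoo P0_palm
    (measurableC mC') (measurableC mA) (probability_setC_eq0 mC' C1)) => w n.
  by rewrite /setC /= HC'.
Qed.

End ergodicity.

(** * Tails and runs of independent variables *)

Section tails.
Context d (T : measurableType d) (R : realType) (P : probability T R).

Lemma measurable_gt_set (V : T -> R) x : measurable_fun setT V ->
  measurable [set w | (x < V w)%R].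
Proof. by move=> mV; exact: (measurable_ltr_set (measurable_cst x) mV). Qed.

Lemma measurable_le_set (V : T -> R) x : measurable_fun setT V ->
  measurable [set w | (V w <= x)%R].
Proof.
move=> mV; rewrite (_ : [set w | _] = ~` [set w | (x < V w)%R]).
  exact/measurableC/measurable_gt_set.
by apply/seteqP; split => w /=; rewrite leNgt => /negP.
Qed.

Lemma tail_cvg0 (V : T -> R) : measurable_fun setT V ->
  P [set w | (n%:R < V w)%R] @[n --> \oo] --> 0.
Proof.
move=> mV; pose F (n : nat) := [set w | (n%:R < V w)%R].
have mF n : measurable (F n) by exact: measurable_gt_set.
have <- : P (\bigcap_n F n) = 0.
  rewrite (_ : \bigcap_n F n = set0) ?measure0//; apply/seteqP; split => // w Fw.
  have := Fw (Num.bound `|V w|%R) Logic.I; rewrite /F /= ltNge => /negP; apply.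
  by rewrite (le_trans (ler_norm _))//; apply/ltW/archi_boundP.
apply: nonincreasing_cvg_mu => //.
- by apply: le_lt_trans (probability_le1 P (mF 0%N)) _; rewrite ltry.
- exact: bigcapT_measurable.
- move=> m n mn; apply/subsetPset => w /=; apply: le_lt_trans.
  by rewrite ler_nat.
Qed.

(** The event prescribes [A] at the first [n] indices and [B] at the next one:
    a single instance of mutual independence. *)
Lemma iid_first_run (Y : nat -> T -> R) (A B : set R) (n : nat) (g : R) :
  iid P Y -> measurable A -> measurable B -> P (Y 0%N @^-1` A) = g%:E ->
  P ([set w | forall j, (j < n)%N -> A (Y j w)] `&` Y n @^-1` B) =
  (g ^+ n)%:E * P (Y 0%N @^-1` B).
Proof.
move=> [ind idd] mA mB gA.
pose J := seq_fset tt (iota 0 n.+1).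
have inJ j : (j \in J) = (j < n.+1)%N by rewrite seq_fsetE mem_iota.
pose C (j : nat) := if (j < n)%N then A else B.
have mC j : measurable (C j) by rewrite /C; case: ifP.
have := ind J C mC.
rewrite (_ : \bigcap_(i in _) _ =
    [set w | forall j, (j < n)%N -> A (Y j w)] `&` Y n @^-1` B); last first.
  apply/seteqP; split => [w Hw|w [Hw HB] j].
    split=> [j jn|].
      have := Hw j; rewrite /C /= jn; apply.
      by rewrite /= inJ ltnS ltnW.
    by have := Hw n; rewrite /C /= ltnn; apply; rewrite /= inJ.
  rewrite /= inJ ltnS leq_eqVlt => /predU1P[->|jn].
    by rewrite /C ltnn.
  by rewrite /C jn; exact: Hw.
move=> ->.
have pJ : perm_eq (enum_fset J) (iota 0 n.+1).
  apply: uniq_perm; [exact: fset_uniq|exact: iota_uniq|].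
  by move=> j; rewrite inJ mem_iota.
rewrite (perm_big _ pJ) -addn1 iotaD big_cat/= big_seq1 add0n.
congr (_ * _); last by rewrite /C ltnn; exact: idd.
rewrite (eq_big_seq (fun=> g%:E)) => [|j].
  rewrite big_const_seq count_predT size_iota.
  by elim: (n) => [|k IH]; rewrite ?expr0// iterS IH exprS EFinM.
by rewrite mem_iota add0n /C => /andP[_ ->]; rewrite -gA; exact: idd.
Qed.

End tails.

(** * The time lost in failed attempts *)

Section restart.
Variable R : realType.
Variable P0 : probability (config R) R.
Implicit Types (m : config R).

Lemma L_ge0 n i m : (0 <= L n i m)%R.
Proof. by rewrite /L. Qed.

Definition failed (i : nat) : set (config R) :=
  [set m | forall j, (j <= i)%N -> (L 0 j m <= D 0 m)%R].

Lemma measurable_failed i : measurable (failed i).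
Proof.
rewrite (_ : failed i = \bigcap_(j in [set j | (j <= i)%N])
    ~` [set m : config R | (D 0 m < L 0 j m)%R]).
  apply: bigcap_measurableType => j _; apply: measurableC.
  by apply: measurable_ltr_set; [exact: measurable_D|exact: measurable_L].
apply/seteqP; split => m H j ji; have := H j ji; rewrite /= leNgt => /negP//.
Qed.

(** [tau] numbers the attempts from 1 and the marks are numbered from 0, so
    [L 0 i] is lost when the attempts number 1 to [i + 1] fail. *)
Lemma lt_tau i m : ((i.+1%:R : R)%:E < tau 0 m) = (m \in failed i).
Proof.
apply/idP/idP => [it|/set_mem H].
  apply/mem_set => j ji; rewrite leNgt; apply/negP => DL.
  move: it; rewrite ltNge => /negP; apply.
  apply: (@le_trans _ _ (j.+1%:R : R)%:E); last by rewrite lee_fin ler_nat.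
  by apply: ereal_inf_lbound; exists j.
apply: (@lt_le_trans _ _ (i.+2%:R : R)%:E); first by rewrite lte_fin ltr_nat.
apply: le_ereal_inf_tmp => _ [j DL <-]; rewrite lee_fin ler_nat ltnS ltnNge.
by apply/negP => ji; have := H j ji; rewrite leNgt DL.
Qed.

Definition lost_time m : \bar R :=
  \sum_(0 <= i <oo) (\1_(failed i) m * L 0 i m)%:E.

Lemma TR_lost_time m : TR 0 m = lost_time m + (D 0 m)%:E.
Proof.
rewrite /TR /lost_time eseries_mkcond; congr (limn _ + _).
apply/funext => n; apply: eq_bigr => i _.
by rewrite lt_tau indicE; case: ifP => _; rewrite ?mul1r ?mul0r.
Qed.

Let term_ge0 i m : 0 <= (\1_(failed i) m * L 0 i m)%:E.
Proof. by rewrite lee_fin mulr_ge0// L_ge0. Qed.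

Lemma lost_time_ge0 m : 0 <= lost_time m.
Proof. by apply: nneseries_ge0 => i _ _; exact: term_ge0. Qed.

Lemma measurable_lost_time : measurable_fun setT lost_time.
Proof.
rewrite [X in measurable_fun _ X](_ : _ = (fun m =>
   \sum_(0 <= i <oo | i \in predT) (\1_(failed i) m * L 0 i m)%:E)) //.
apply: ge0_emeasurable_sum => // i _; apply/measurable_EFinP.
apply: measurable_funM; last exact: measurable_L.
by apply: measurable_indic; exact: measurable_failed.
Qed.

Lemma measurable_TR : measurable_fun setT (@TR R 0).
Proof.
rewrite [X in measurable_fun _ X](_ : _ = lost_time \+ (EFin \o @D R 0)).
  apply: emeasurable_funD; first exact: measurable_lost_time.
  by apply/measurable_EFinP; exact: measurable_D.
by apply/funext => m; rewrite TR_lost_time.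
Qed.

Lemma lost_time_ltoo m : (exists i, (D 0 m < L 0 i m)%R) -> lost_time m < +oo.
Proof.
move=> [i DL]; rewrite /lost_time (nneseries_split _ i)//.
rewrite add0n eseries0 ?adde0.
  by rewrite sumEFin ltry.
move=> k ik _; rewrite indicE memNset ?mul0r// => /(_ i ik).
by rewrite leNgt DL.
Qed.

Hypothesis L_iid : iid P0 (fun i : nat => @L R 0 i).
Hypothesis L_D_indep : independent P0 (@K R 0) (@D R 0).
Hypothesis L_supp : unbounded_support P0 (@L R 0 0).

Let g (x : R) : R := fine (P0 [set m | (L 0 0 m <= x)%R]).

Let gE x : P0 [set m | (L 0 0 m <= x)%R] = (g x)%:E.
Proof.
by rewrite /g fineK// fin_num_measure//; apply: measurable_le_set; exact: measurable_L.
Qed.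

Let tailE x : P0 [set m | (x < L 0 0 m)%R] = (1 - g x)%:E.
Proof.
rewrite (_ : [set m | (x < L 0 0 m)%R] = ~` [set m : config R | (L 0 0 m <= x)%R]).
  rewrite probability_setC ?gE//; apply: measurable_le_set; exact: measurable_L.
by apply/seteqP; split => m /=; rewrite ltNge => /negP.
Qed.

Let g_ge0 x : (0 <= g x)%R. Proof. exact/fine_ge0/measure_ge0. Qed.

Let g_lt1 x : (0 <= x)%R -> (g x < 1)%R.
Proof. by move=> /L_supp; rewrite tailE lte_fin subr_gt0. Qed.

(** If all attempts fail then [D 0 > k] or all marks are at most [k]; the second
    event is null because [L] exceeds [k] with positive probability, and the
    first one is improbable for large [k]. *)
Lemma attempts_succeed_ae : {ae P0, forall m, exists i, (D 0 m < L 0 i m)%R}.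
Proof.
pose N := \bigcap_i failed i.
have mN : measurable N by apply: bigcapT_measurable => i; exact: measurable_failed.
suff N0 : P0 N = 0.
  apply: filterS (measure0_aeN mN N0) => m Nm; apply: contrapT => H; apply: Nm.
  move=> i _ j _; rewrite leNgt; apply/negP => DL; apply: H; by exists j.
have run x n : (0 <= x)%R -> P0 N <= P0 [set m | (x < D 0 m)%R] + (g x ^+ n)%:E.
  move=> x0.
  pose F := [set m | forall j, (j < n)%N -> (L 0 j m <= x)%R] `&`
    (@L R 0 n @^-1` setT).
  have PF : P0 F = (g x ^+ n)%:E.
    have /= := @iid_first_run _ _ _ P0 _ `]-oo, x]%classic setT n (g x) L_iid
       (measurable_itv _) measurableT.
    rewrite preimage_setT probability_setT mule1 => <-.
      congr (P0 _); apply/seteqP; split => m [H _];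
        by split => // j /H /=; rewrite in_itv.
    by rewrite -gE; congr (P0 _); apply/seteqP; split => m /=; rewrite in_itv.
  have mF : measurable F.
    rewrite /F preimage_setT setIT (_ : [set m | _] =
      \bigcap_(j in [set j | (j < n)%N]) [set m | (L 0 j m <= x)%R]).
      apply: bigcap_measurableType => j _.
      by apply: measurable_le_set; exact: measurable_L.
    by apply/seteqP; split.
  have mD : measurable [set m : config R | (x < D 0 m)%R].
    by apply: measurable_gt_set; exact: measurable_D.
  rewrite -PF; apply: le_trans (measureU2 _ mD mF).
  apply: le_measure; rewrite ?inE//; first exact: measurableU.
  move=> m Nm; have [Dx|xD] := leP (D 0 m) x; [right|by left].
  by split => // j jn; apply: le_trans Dx; exact: (Nm j Logic.I j (leqnn j)).
have tail k : P0 N <= P0 [set m | (k%:R < D 0 m)%R].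
  have gk : (`|g k%:R| < 1)%R by rewrite ger0_norm// g_lt1.
  have mD : measurable [set m : config R | (k%:R < D 0 m)%R].
    by apply: measurable_gt_set; exact: measurable_D.
  apply/lee_addgt0Pr => e e0.
  have /cvgrPdist_lt /(_ e e0) [n _ /(_ n (leqnn n))] := cvg_expr gk.
  rewrite /= sub0r normrN => Hn; apply: (le_trans (run k%:R n _)) => //.
  by rewrite leeD2l// lee_fin (le_trans (ler_norm _))// ltW.
apply/eqP; rewrite eq_le measure_ge0 andbT.
rewrite -(cvg_lim _ (tail_cvg0 P0 (@measurable_D R 0)))//.
apply: lime_ge; last exact: nearW.
by apply/cvg_ex; exists 0; exact: tail_cvg0 (@measurable_D R 0).
Qed.

Lemma TR_ltoo_ae : {ae P0, forall m, TR 0 m < +oo}.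
Proof.
apply: filterS attempts_succeed_ae => m Hm.
by rewrite TR_lost_time lte_add_pinfty ?ltry// lost_time_ltoo.
Qed.

Let P0_first_run (x : R) n : (1 <= x)%R ->
  P0 ([set m | forall j, (j < n)%N -> (L 0 j m <= x)%R] `&`
      [set m | (1 < L 0 n m <= x)%R]) = (g x ^+ n * (g x - g 1))%:E.
Proof.
move=> x1.
have /= := @iid_first_run _ _ _ P0 _ `]-oo, x]%classic `]1%R, x]%classic n (g x) L_iid
   (measurable_itv _) (measurable_itv _).
have -> : [set m | forall j, (j < n)%N -> `]-oo, x]%classic (L 0 j m)] =
    [set m : config R | forall j, (j < n)%N -> (L 0 j m <= x)%R].
  by apply/seteqP; split => m H j /H /=; rewrite in_itv.
have itvE (j : nat) : @L R 0 j @^-1` `]1%R, x]%classic = [set m | (1 < L 0 j m <= x)%R].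
  by apply/seteqP; split => m /=; rewrite in_itv.
rewrite !itvE => ->; last first.
  by rewrite -gE; congr (P0 _); apply/seteqP; split => m /=; rewrite in_itv.
rewrite EFinM; congr (_ * _).
have -> : [set m | (1 < L 0 0 m <= x)%R] =
    [set m : config R | (L 0 0 m <= x)%R] `\` [set m | (L 0 0 m <= 1)%R].
  apply/seteqP; split => m /=.
    by move=> /andP[h1 h2]; split => //; apply/negP; rewrite -ltNge.
  by move=> [h1 /negP]; rewrite -ltNge h1 => ->.
have mL y : measurable [set m : config R | (L 0 0 m <= y)%R].
  by apply: measurable_le_set; exact: measurable_L.
rewrite measureD//; last first.
  by apply: le_lt_trans (probability_le1 P0 (mL x)) _; rewrite ltry.
rewrite (_ : _ `&` _ = [set m | (L 0 0 m <= 1)%R]).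
  by rewrite EFinB; congr (_ - _); exact: gE.
by apply/seteqP; split => m /= => [[]//|h]; split => //; exact: le_trans x1.
Qed.

(** On the event [x < D 0], the attempt [i] fails whenever the marks up to [i] are at
    most [x]; it then costs at least 1 if its mark exceeds 1. These events depend
    on the marks only, so they are independent of [D 0], and their
    probabilities form a geometric series of ratio [g x]. The hypothesis on
    [D 0] cancels the factor [1 - g x] of its partial sums. *)
Lemma lost_time_beyond_ge (x : R) n : (1 <= x)%R ->
  (1 - g x)%:E <= P0 [set m | (x < D 0 m)%R] ->
  ((g x - g 1) * (1 - g x ^+ n))%:E <=
  \int[P0]_(m in [set m | (x < D 0 m)%R]) lost_time m.
Proof.
move=> x1 DL; set A := [set m | _].
have mA : measurable A by apply: measurable_gt_set; exact: measurable_D.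
pose F i := [set m | forall j, (j < i)%N -> (L 0 j m <= x)%R] `&`
  [set m | (1 < L 0 i m <= x)%R].
pose KF i := [set k : marks R |
  (forall j, (j < i)%N -> ((k : mark_seq R) j)%:num <= x)%R] `&`
  [set k | (1 < ((k : mark_seq R) i)%:num <= x)%R].
have mKF i : measurable (KF i).
  apply: measurableI.
    rewrite (_ : [set k | _] = \bigcap_(j in [set j | (j < i)%N])
        [set k : marks R | (((k : mark_seq R) j)%:num <= x)%R]).
      apply: bigcap_measurableType => j _.
      by apply: measurable_le_set; exact: measurable_mark.
    by apply/seteqP; split.
  rewrite (_ : [set k | _] = [set k : marks R | (1 < ((k : mark_seq R) i)%:num)%R] `&`
      [set k : marks R | (((k : mark_seq R) i)%:num <= x)%R]).
    apply: measurableI; first by apply: measurable_gt_set; exact: measurable_mark.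
    by apply: measurable_le_set; exact: measurable_mark.
  by apply/seteqP; split => k /= => [/andP[]|[-> ->]].
have FK i : F i = @K R 0 @^-1` (KF i) by [].
have mF i : measurable (F i).
  by rewrite FK -[X in measurable X]setTI; exact: measurable_K.
have PFA i : P0 (F i `&` A) = (g x ^+ i * (g x - g 1))%:E * P0 A.
  rewrite -P0_first_run// -/(F i) FK.
  have -> : A = @D R 0 @^-1` `]x, +oo[%classic.
    by apply/seteqP; split => m /=; rewrite in_itv/= andbT.
  by apply: L_D_indep => //; exact: measurable_itv.
have g1x : (g 1 <= g x)%R.
  rewrite -lee_fin -!gE; apply: le_measure; rewrite ?inE.
  - by apply: measurable_le_set; exact: measurable_L.
  - by apply: measurable_le_set; exact: measurable_L.
  - by move=> m /= /le_trans; apply.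
have gx1 : (g x < 1)%R by apply: g_lt1; exact: le_trans x1.
have mF1 i : measurable_fun A (fun m => (\1_(F i) m : R)%:E).
  by apply: measurable_funTS; apply/measurable_EFinP; exact: measurable_indic.
apply: (@le_trans _ _ (\int[P0]_(m in A) \sum_(0 <= i < n) (\1_(F i) m)%:E)).
  rewrite ge0_integral_sum//.
  apply: (@le_trans _ _
    (\sum_(0 <= i < n) (g x ^+ i * (g x - g 1))%:E * (1 - g x)%:E)).
    under eq_bigr do rewrite -EFinM.
    rewrite sumEFin lee_fin; under eq_bigr do rewrite -mulrA.
    rewrite -mulr_suml big_mkord.
    have := subrX1 (g x) n; set s := (\sum_(_ < _) _)%R => h.
    have -> : (1 - g x ^+ n = (1 - g x) * s)%R by rewrite -[LHS]opprB h; ring.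
    by rewrite [leRHS]mulrC mulrA.
  apply: lee_sum => i _; rewrite integral_indic// [leRHS]PFA.
  by apply: lee_wpmul2l => //; rewrite lee_fin mulr_ge0 ?exprn_ge0// subr_ge0.
apply: ge0_le_integral => //.
- by move=> m _; apply: sume_ge0 => i _; rewrite lee_fin.
- exact: emeasurable_sum.
- by apply: measurable_funTS; exact: measurable_lost_time.
move=> m Am; apply: (le_trans _ (nneseries_lim_ge n _)) => //.
apply: lee_sum => i _; rewrite lee_fin [X in (X <= _)%R]indicE.
have [/set_mem[run /andP[Li1 Lix]]|_] := boolP (m \in F i); last first.
  by rewrite mulr_ge0// L_ge0.
rewrite indicE mem_set ?mul1r; first exact: ltW.
move=> j; rewrite leq_eqVlt => /predU1P[->|ji]; apply: le_trans (ltW Am) => //.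
exact: run.
Qed.

(** Were the mean finite, the integral over [D 0 > k] would become smaller than
    [q / 4], where [q] is the probability that [L] exceeds 1. But it is at least
    [(g k - g 1) (1 - g k ^+ n)], where the first factor exceeds [q / 2] for
    large [k] and the second one exceeds 1/2 for large [n]. *)
Lemma lost_time_infinite_mean (V : config R -> R) :
  (forall t, P0 [set m | (t < V m)%R] = P0 [set m | (t < L 0 0 m)%R]) ->
  heavier_tail P0 (@D R 0) V -> \int[P0]_m lost_time m = +oo.
Proof.
move=> VL [z0 DV]; apply/eqP; rewrite -leye_eq leNgt; apply/negP => Woo.
have W0 : 0 <= \int[P0]_m lost_time m.
  by apply: integral_ge0 => m _; exact: lost_time_ge0.
have Wfin : \int[P0]_m lost_time m \is a fin_num by rewrite ge0_fin_numE.
pose q := (1 - g 1)%R; have q0 : (0 < q)%R by rewrite subr_gt0 g_lt1.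
pose B (k : nat) := [set m : config R | (D 0 m <= k%:R)%R].
have mB k : measurable (B k) by apply: measurable_le_set; exact: measurable_D.
have cvgB : \int[P0]_(m in B k) lost_time m @[k --> \oo] --> \int[P0]_m lost_time m.
  have <- : \bigcup_k B k = setT.
    apply/seteqP; split => // m _; exists (Num.bound `|D 0 m|%R) => //=.
    by rewrite /B /= (le_trans (ler_norm _))//; apply/ltW/archi_boundP.
  apply: ge0_nondecreasing_set_cvg_integral => //.
  - move=> i j ij; apply/subsetPset => m /= /le_trans; apply.
    by rewrite ler_nat.
  - by move=> i; apply: measurable_funTS; exact: measurable_lost_time.
  - by move=> i m _; exact: lost_time_ge0.
have cvgL := tail_cvg0 P0 (measurable_L 0 0).
have near1 : \forall k \near \oo,
    \int[P0]_m lost_time m - (q / 4)%:E < \int[P0]_(m in B k) lost_time m.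
  have Wq : \int[P0]_m lost_time m - (q / 4)%:E < \int[P0]_m lost_time m.
    by rewrite lteBlDr// lteDl// lte_fin divr_gt0.
  exact: cvgB _ (open_ereal_gt' Wq).
have near2 : \forall k \near \oo, (1 - g k%:R < q / 2)%R.
  have : \forall k \near \oo, P0 [set m | (k%:R < L 0 0 m)%R] < (q / 2)%:E.
    have q20 : 0 < (q / 2)%:E by rewrite lte_fin divr_gt0.
    exact: cvgL _ (open_ereal_lt' q20).
  by apply: filterS => k; rewrite tailE lte_fin.
have [k [k1 kz h1 h2]] : exists k : nat, [/\ (1 <= k%:R :> R)%R, (z0 <= k%:R)%R,
    \int[P0]_m lost_time m - (q / 4)%:E < \int[P0]_(m in B k) lost_time m &
    (1 - g k%:R < q / 2)%R].
  near \oo => k; exists k; split.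
  - by near: k; exact: nbhs_infty_ger.
  - by near: k; exact: nbhs_infty_ger.
  - by near: k.
  - by near: k.
have DL : (1 - g k%:R)%:E <= P0 [set m | (k%:R < D 0 m)%R].
  by rewrite -tailE -VL; exact: DV.
have gk1 : (g k%:R < 1)%R by apply: g_lt1; exact: le_trans k1.
have [n gn] : exists n, (g k%:R ^+ n < 1 / 2)%R.
  have gk : (`|g k%:R| < 1)%R by rewrite ger0_norm.
  have e0 : (0 < 1 / 2 :> R)%R by lra.
  have /cvgrPdist_lt /(_ _ e0) [n _ /(_ n (leqnn n))] := cvg_expr gk.
  rewrite /= sub0r normrN => Hn; exists n; exact: le_lt_trans (ler_norm _) Hn.
have := lost_time_beyond_ge n k1 DL.
have AB : [set m : config R | (k%:R < D 0 m)%R] = ~` B k.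
  by apply/seteqP; split => m /=; rewrite /B ltNge => /negP.
rewrite AB => h3.
have split_int : \int[P0]_m lost_time m =
    \int[P0]_(m in B k) lost_time m + \int[P0]_(m in ~` B k) lost_time m.
  rewrite -ge0_integral_setU ?setUv//.
  - exact: measurableC.
  - exact: measurable_lost_time.
  - by move=> m _; exact: lost_time_ge0.
  - by rewrite disj_set2E setICr.
have intle C : measurable C -> \int[P0]_(m in C) lost_time m <= \int[P0]_m lost_time m.
  move=> mC; apply: ge0_subset_integral => //; first exact: measurable_lost_time.
  by move=> m _; exact: lost_time_ge0.
have intfin C : measurable C -> \int[P0]_(m in C) lost_time m \is a fin_num.
  move=> mC; rewrite ge0_fin_numE; first exact: le_lt_trans (intle C mC) Woo.
  by apply: integral_ge0 => m _; exact: lost_time_ge0.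
move: h1 h3; rewrite split_int.
rewrite -(fineK (intfin _ (mB k))) -(fineK (intfin _ (measurableC (mB k)))).
rewrite -!EFinD lte_fin lee_fin => h1 h3.
have : (q / 4 <= (g k%:R - g 1) * (1 - g k%:R ^+ n))%R.
  have h4 : (q / 2 <= g k%:R - g 1)%R by rewrite /q in h2 *; lra.
  have h5 : (1 / 2 <= 1 - g k%:R ^+ n)%R by lra.
  by apply: le_trans (ler_pM _ _ h4 h5); lra.
lra.
Unshelve. all: by end_near.
Qed.

Lemma TR_infinite_mean (V : config R -> R) :
  (forall t, P0 [set m | (t < V m)%R] = P0 [set m | (t < L 0 0 m)%R]) ->
  {ae P0, forall m, (0 < D 0 m)%R} ->
  heavier_tail P0 (@D R 0) V -> \int[P0]_m TR 0 m = +oo.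
Proof.
move=> VL D0 DV.
have mW := measurable_lost_time.
rewrite (@ae_integral_eq _ _ _ P0 _ (fun m => lost_time m + (Num.max 0 (D 0 m))%:E))//.
- apply/eqP; rewrite -leye_eq -(lost_time_infinite_mean VL DV).
  apply: ge0_le_integral => //.
  + by move=> m _; exact: lost_time_ge0.
  + apply: emeasurable_funD => //; apply/measurable_EFinP.
    by apply: measurable_maxr => //; exact: measurable_D.
  + by move=> m _; rewrite leeDl// lee_fin le_max lexx.
- exact: measurable_TR.
- apply: emeasurable_funD => //; apply/measurable_EFinP.
  by apply: measurable_maxr => //; exact: measurable_D.
- by apply: filterS D0 => m /ltW D0; rewrite TR_lost_time max_r.
Qed.

End restart.

(** * The efficiency of restart *)

Section ratio.
Variable R : realType.

(** An infinite [y] is the case of a denominator without mean; there [x / y] is 0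
    and finiteness of [x] forces the ratio to vanish. *)
Lemma cvg_ereal_ratio (a b : nat -> R) (x y : \bar R) :
  (a n)%:E @[n --> \oo] --> x -> (b n)%:E @[n --> \oo] --> y ->
  x \is a fin_num -> 0 < y -> (forall n, (0 < n)%N -> (0 < b n)%R) ->
  (a n / b n)%:E @[n --> \oo] --> x / y.
Proof.
move=> ax + /fineK xfin y0 b0; rewrite -xfin in ax *.
have {}ax : a n @[n --> \oo] --> fine x by move/fine_cvgP : ax => [].
case: y y0 => [r|_|//]; last first.
  move=> /cvgeryP bo; rewrite invey mule0; apply/cvg_EFin; first exact: nearW.
  have -> : (0 = fine x * 0 :> R)%R by rewrite mulr0.
  apply: cvgM => //; apply/gtr0_cvgV0; last exact: bo.
  by exists 1%N.
rewrite lte_fin => r0 br.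
have {}br : b n @[n --> \oo] --> r by move/fine_cvgP : br => [].
rewrite inver gt_eqF// -EFinM; apply/cvg_EFin; first exact: nearW.
by apply: cvgM => //; apply: cvgV => //; rewrite gt_eqF.
Qed.

End ratio.

(** The preimages of a null set under the iterates are null, and they are
    countably many. *)
Lemma ae_iter d (T : measurableType d) (R : realType) (mu : probability T R)
    (th : T -> T) (Q : T -> Prop) :
  measurable_fun setT th -> (forall A, measurable A -> mu (th @^-1` A) = mu A) ->
  {ae mu, forall x, Q x} -> {ae mu, forall x, forall n, Q (iter n th x)}.
Proof.
move=> mth mu_th [N [mN N0 QN]]; apply: ae_foralln => n.
have H : measurable (iter n th @^-1` N) /\ mu (iter n th @^-1` N) = 0.
  elim: n => [|n [mn n0]]; first by split.
  have E : iter n.+1 th @^-1` N = th @^-1` (iter n th @^-1` N).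
    by apply/seteqP; split => x /=; rewrite -iterSr.
  rewrite E mu_th//; split => //; rewrite -[X in measurable X]setTI.
  exact: mth.
by exists (iter n th @^-1` N); split; [exact: H.1|exact: H.2|move=> x /QN].
Qed.

Theorem theorem6 (R : realType) (d : measure_display)
    (Omega : measurableType d) (P : probability Omega R)
    (theta : R -> Omega -> Omega) (Phi : Omega -> config R)
    (P0 : probability (config R) R) (L0 : {RV P0 >-> R})
    (theta_flow : measurable_flow theta)
    (Phi_mpp : marked_point_process Phi)
    (Phi_stationary : stationary P theta Phi)
    (intensity_gt0 : 0 < intensity P Phi)
    (intensity_ltoo : intensity P Phi < +oo)
    (P0_palm : is_palm P Phi P0)
    (L_iid : forall n : nat, iid P0 (fun i : nat => @L R n%:Z i))
    (L_D_indep : forall n : nat, independent P0 (@K R n%:Z) (@D R n%:Z))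
    (D_supp : unbounded_support P0 (@D R 0))
    (L_supp : unbounded_support P0 (@L R 0 0))
    (D_mean : \int[P0]_m (D 0 m)%:E < +oo)
    (L_mean : \int[P0]_m (L 0 0 m)%:E < +oo)
    (L0_law : forall (n : int) (i : nat) (t : R),
       P0 [set m | (t < L0 m)%R] = P0 [set m | (t < L n i m)%R]) :
  let I := invariant_sets (@shift R) in
  let ED := cond_exp P0 I (fun m => (D 0 m)%:E) in
  let ET := cond_exp P0 I (@TR R 0) in
  let ergodic := ergodic_flow P theta \/ ergodic_map P0 (@shift R) in
  [/\ (strictly_heavier_tail P0 L0 (@D R 0) ->
         has_asymptotic_efficiency P0 (fun m => ED m / ET m)),
      (ergodic_flow P theta -> ergodic_map P0 (@shift R)) /\
      (generated_by Phi ->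
         (ergodic_flow P theta <-> ergodic_map P0 (@shift R))),
      (ergodic ->
         [/\ {ae P0, forall m, ED m = \int[P0]_m' (D 0 m')%:E},
             {ae P0, forall m, ET m = \int[P0]_m' TR 0 m'} &
             strictly_heavier_tail P0 L0 (@D R 0) ->
               has_asymptotic_efficiency P0
                 (fun=> (\int[P0]_m (D 0 m)%:E) / (\int[P0]_m TR 0 m))]),
      (heavier_tail P0 (@D R 0) L0 -> \int[P0]_m TR 0 m = +oo) &
      (ergodic -> \int[P0]_m TR 0 m = +oo ->
         has_asymptotic_efficiency P0 (fun=> 0))].
Proof.
move=> I ED ET ergodic.
have mth := @measurable_shift R.
have P0_th := palm_shift Phi_mpp intensity_gt0 intensity_ltoo P0_palm.
have D_gt0 : {ae P0, forall m, (0 < D 0 m)%R}.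
  apply: (palm_ae Phi_mpp intensity_gt0 intensity_ltoo P0_palm
    (Q := [set m | (0 < D 0 m)%R])).
    exact: (measurable_gt_set 0%R (@measurable_D R 0)).
  move=> w n; rewrite /= D_recenter subr_gt0 addr0 X_lt_iff; last exact: Phi_mpp.2.
  by lia.
have L_iid0 : iid P0 (fun i : nat => @L R 0 i) := L_iid 0%N.
(* nonnegative real functions for the ergodic theorem: off a null set they are
   [D 0] and [TR 0], which may be negative or infinite elsewhere *)
pose fD (m : config R) := Num.max 0%R (D 0 m).
pose fT (m : config R) := fine (maxe 0 (TR 0 m)).
have mhD : measurable_fun setT (fun m : config R => (D 0 m)%:E).
  by apply/measurable_EFinP; exact: measurable_D.
have mfD : measurable_fun setT fD.
  by apply: measurable_maxr => //; exact: measurable_D.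
have mfT : measurable_fun setT fT.
  by apply: measurableT_comp => //; apply: measurable_maxe => //; exact: measurable_TR.
have fD0 m : (0 <= fD m)%R by rewrite le_max lexx.
have fT0 m : (0 <= fT m)%R by rewrite fine_ge0// le_max lexx.
have DE : {ae P0, forall m, (D 0 m)%:E = (fD m)%:E}.
  by apply: filterS D_gt0 => m /ltW m0; rewrite /fD max_r.
have TR_gt0 : {ae P0, forall m, 0 < TR 0 m}.
  apply: filterS D_gt0 => m m0; rewrite TR_lost_time.
  by rewrite (@lt_le_trans _ _ (D 0 m)%:E)// leeDr// lost_time_ge0.
have TE : {ae P0, forall m, TR 0 m = (fT m)%:E}.
  apply: filterS2 TR_gt0 (TR_ltoo_ae L_iid0 L_supp) => m m0 moo.
  by rewrite /fT max_r ?(ltW m0)// fineK// ge0_fin_numE// ltW.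
have ED_gt0 := cond_exp_gt0 mth P0_th mhD mfD fD0 DE D_gt0.
have ET_gt0 := cond_exp_gt0 mth P0_th (@measurable_TR R) mfT fT0 TE TR_gt0.
have ED_ltoo := cond_exp_ltoo mth P0_th mhD mfD fD0 DE D_mean.
have cvgD := birkhoff mth P0_th mhD mfD fD0 DE.
have cvgT := birkhoff mth P0_th (@measurable_TR R) mfT fT0 TE.
have eff : has_asymptotic_efficiency P0 (fun m => ED m / ET m).
  have orbitD := ae_iter mth P0_th DE.
  have orbitT := ae_iter mth P0_th TE.
  have orbit0 := ae_iter mth P0_th TR_gt0.
  near=> m.
  have Dm : forall n, (D 0 (iter n (@shift R) m))%:E = (fD (iter n (@shift R) m))%:E.
    by near: m.
  have Tm : forall n, TR 0 (iter n (@shift R) m) = (fT (iter n (@shift R) m))%:E.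
    by near: m.
  have T0m : forall n, 0 < TR 0 (iter n (@shift R) m) by near: m.
  have S0 n : (0 < n)%N -> (0 < birkhoff_sum (@shift R) fT n m)%R.
    case: n => // n _; rewrite birkhoff_sumS.
    rewrite ltr_pwDl ?birkhoff_sum_ge0//.
    by have := T0m 0%N; rewrite (Tm 0%N).
  have ratioE N : (0 < N)%N -> efficiency_ratio N m =
      ((birkhoff_sum (@shift R) fD N m / N%:R) /
       (birkhoff_sum (@shift R) fT N m / N%:R))%:E.
    move=> N0; rewrite /efficiency_ratio.
    have -> : \sum_(n < N) (D n%:Z m)%:E = (birkhoff_sum (@shift R) fD N m)%:E.
      by rewrite -sumEFin; apply: eq_bigr => i _; rewrite D_iter_shift Dm.
    have -> : \sum_(n < N) TR n%:Z m = (birkhoff_sum (@shift R) fT N m)%:E.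
      by rewrite -sumEFin; apply: eq_bigr => i _; rewrite TR_iter_shift Tm.
    rewrite inver gt_eqF ?S0// -EFinM; congr EFin.
    have := S0 N N0; have : (0 < N%:R :> R)%R by rewrite ltr0n.
    by move=> /lt0r_neq0 ? /lt0r_neq0 ?; field; apply/andP.
  have cD : birkhoff_mean (@shift R) fD N m @[N --> \oo] --> ED m by near: m.
  have cT : birkhoff_mean (@shift R) fT N m @[N --> \oo] --> ET m by near: m.
  have ED0 : 0 < ED m by near: m.
  have EDoo : ED m < +oo by near: m.
  have ET0 : 0 < ET m by near: m.
  pose mD N := (birkhoff_sum (@shift R) fD N m / N%:R)%R.
  pose mT N := (birkhoff_sum (@shift R) fT N m / N%:R)%R.
  apply: (@cvg_trans _ ((mD N / mT N)%:E @[N --> \oo])).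
    by apply: near_eq_cvg; exists 1%N => // N /= N0; rewrite ratioE.
  apply: cvg_ereal_ratio => //; first by rewrite ge0_fin_numE ?ltW.
  by move=> n n0; rewrite divr_gt0 ?S0// ltr0n.
have flow_map : ergodic_flow P theta -> ergodic_map P0 (@shift R).
  exact: (ergodic_flow_map Phi_mpp Phi_stationary intensity_gt0 intensity_ltoo P0_palm).
have erg_map : ergodic -> ergodic_map P0 (@shift R) by case.
have ED_const : ergodic -> {ae P0, forall m, ED m = \int[P0]_m' (D 0 m')%:E}.
  by move=> /erg_map; exact: (ergodic_cond_expE mth P0_th mhD mfD fD0 DE).
have ET_const : ergodic -> {ae P0, forall m, ET m = \int[P0]_m' TR 0 m'}.
  by move=> /erg_map; exact: (ergodic_cond_expE mth P0_th (@measurable_TR R) mfT fT0 TE).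
have eff_const : ergodic -> has_asymptotic_efficiency P0
    (fun=> (\int[P0]_m (D 0 m)%:E) / (\int[P0]_m TR 0 m)).
  move=> erg; near=> m.
  have <- : ED m = \int[P0]_m (D 0 m)%:E by near: m; exact: ED_const.
  have <- : ET m = \int[P0]_m TR 0 m by near: m; exact: ET_const.
  by near: m; exact: eff.
split.
- by [].
- split=> // gen; split=> //.
  exact: (ergodic_map_flow Phi_mpp Phi_stationary intensity_gt0 intensity_ltoo
    P0_palm gen).
- by move=> erg; split; [exact: ED_const|exact: ET_const|move=> _; exact: eff_const].
- apply: (TR_infinite_mean L_iid0 (L_D_indep 0%N) L_supp _ D_gt0).
  exact: (L0_law 0%R 0%N).
- by move=> erg TRoo; have := eff_const erg; rewrite TRoo invey mule0.
Unshelve. all: by end_near.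
Qed.
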